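(* Let $\{G_n\}$ be a sequence of finite connected vertex transitive graphs with $|G_n|\to\infty$, such that simple random walk on each $G_n$ is aperiodic. Let $\mathcal{C}_n$ denote the cover time for simple random walk on $G_n$, and let $G_n^\diamondsuit=\mathbb{Z}_2\wr G_n$ with the lamplighter walk driven by simple random walk on $G_n$. For every $\epsilon\in(0,1)$ there exist constants $c_1,c_2\in(0,\infty)$ depending on $\epsilon$ such that, as $n\to\infty$, $$[c_1+o(1)]\,\mathbb{E}\mathcal{C}_n\le\mathcal{T}_{\mathrm v}(\epsilon,G_n^\diamondsuit)\le[c_2+o(1)]\,\mathbb{E}\mathcal{C}_n.$$ Moreover, if the maximal hitting time satisfies $t^*(G_n)=o(\mathbb{E}\mathcal{C}_n)$, then for all $\epsilon\in(0,1)$, $$\left[\tfrac12+o(1)\right]\mathbb{E}\mathcal{C}_n\le\mathcal{T}_{\mathrm v}(\epsilon,G_n^\diamondsuit)\le[1+o(1)]\,\mathbb{E}\mathcal{C}_n.$$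
   Context: Graphs have no multiple edges; loops are allowed. $|G|$ is the number of vertices of $G$. For a finite graph $G$ with vertex set $V_G$, the lamplighter graph $G^\diamondsuit=\mathbb{Z}_2\wr G$ has vertices the pairs $(f,x)$ with $f\in\{0,1\}^{V_G}$ and $x\in V_G$. Given the transition probabilities $q(\cdot,\cdot)$ of a random walk on $G$ (here simple random walk), the lamplighter walk on $G^\diamondsuit$ has transition probabilities: for $a\ne b$, $p[(f,a),(h,b)]=q(a,b)/4$ if $f$ and $h$ agree outside $\{a,b\}$; for $a=b$, $p[(f,a),(h,a)]=q(a,a)/2$ if $f$ and $h$ agree outside $\{a\}$; all other transition probabilities are $0$. For a chain with state space $H$, $t$-step transition probabilities $p^t$ and stationary distribution $\mu$, the $\epsilon$-mixing time in total variation is $\mathcal{T}_{\mathrm v}(\epsilon,H)=\min\{t:\frac12\sum_y|p^t(x,y)-\mu(y)|\le\epsilon\ \forall x\in H\}$; $\mathcal{T}_{\mathrm v}(\epsilon,G_n^\diamondsuit)$ refers to the lamplighter walk. The cover time is the first time at which the walk on $G_n$ has visited every vertex (by transitivity its law does not depend on the starting vertex). The maximal hitting time is $t^*(G)=\max_{x,y}\mathbb{E}_xT_y$, where $T_y$ is the hitting time of $y$ by the walk on $G$. *)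

(* Defs.v *)
From mathcomp Require Import all_boot all_order all_fingroup all_algebra.
From mathcomp Require Import all_classical all_reals all_analysis.

Set Implicit Arguments.
Unset Strict Implicit.
Unset Printing Implicit Defensive.

Import Order.TTheory GRing.Theory Num.Theory.
Import numFieldNormedType.Exports.

Local Open Scope classical_set_scope.
Local Open Scope ring_scope.

(* [adj] is not required to be irreflexive: loops are allowed.  Being a
   relation, it excludes multiple edges. *)
Record fin_graph := FinGraph {
  vertex :> finType;
  adj : rel vertex;
  adj_sym : symmetric adj }.

Definition graph_connected (G : fin_graph) : Prop :=
  forall x y : G, connect (@adj G) x y.

Definition vertex_transitive (G : fin_graph) : Prop :=
  forall x y : G, exists s : {perm G},
    (forall u v : G, adj (s u) (s v) = adj u v) /\ s x = y.

Section Chains.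
Variables (R : realType) (S : finType).
Implicit Types (p : S -> S -> R) (mu : S -> R) (x y : S).

Fixpoint step_prob p (t : nat) x y : R :=
  if t is t'.+1 then \sum_(z : S) p x z * step_prob p t' z y else (x == y)%:R.

(* The gcd of the possible return times to any state is 1. *)
Definition aperiodic p : Prop :=
  forall (x : S) (d : nat),
    (forall t : nat, (0 < t)%N -> 0 < step_prob p t x x -> (d %| t)%N) ->
    d = 1%N.

Definition stationary p mu : Prop :=
  [/\ forall x, 0 <= mu x, \sum_(x : S) mu x = 1 &
      forall y, \sum_(x : S) mu x * p x y = mu y].

(* As an infimum in [\bar R] of a set of integers, this is the minimum of the
   set if it is nonempty, and +oo otherwise. *)
Definition mixing_time p mu (eps : R) : \bar R :=
  ereal_inf [set (t%:R)%:E | t in [set t : nat |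
    forall x, 2^-1 * (\sum_(y : S) `|step_prob p t x y - mu y|) <= eps]].

(* Probability that the walk started at [x] moves successively along [w]. *)
Fixpoint path_prob p x (w : seq S) : R :=
  if w is y :: w' then p x y * path_prob p y w' else 1.

(* For a trajectory [w] = X_0, X_1, ... (so that X_0, ..., X_t has length
   t + 1), t is the first time at which X_0, ..., X_t satisfies [A]. *)
Definition first_time (A : pred (seq S)) (t : nat) (w : seq S) : bool :=
  A (take t.+1 w) && [forall s : 'I_t, ~~ A (take s.+1 w)].

(* P_x(tau = t), where tau is the first time at which the trajectory
   satisfies [A]; the event only depends on the first t steps. *)
Definition prob_first_time p (A : pred (seq S)) x (t : nat) : R :=
  \sum_(w : t.-tuple S | first_time A t (x :: w)) path_prob p x w.

(* E_x[tau] = sum_t t P_x(tau = t) + oo P_x(tau = oo), with 0 * oo = 0. *)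
Definition expected_first_time p (A : pred (seq S)) x : \bar R :=
  (\sum_(0 <= t <oo) (t%:R * prob_first_time p A x t)%:E
   + +oo * (1 - \sum_(0 <= t <oo) (prob_first_time p A x t)%:E))%E.

Definition expected_hitting_time p x y : \bar R :=
  expected_first_time p (fun w => y \in w) x.

Definition expected_cover_time p x : \bar R :=
  expected_first_time p (fun w => [forall y : S, y \in w]) x.

(* Hitting times are nonnegative, so 0 is a neutral initial value. *)
Definition max_hitting_time p : \bar R :=
  \big[maxe/0%E]_(xy : S * S) expected_hitting_time p xy.1 xy.2.

End Chains.

(* A loop at [x] makes [x] one of its own neighbours, counted once. *)
Definition srw (R : realType) (G : fin_graph) (x y : G) : R :=
  (adj x y)%:R / #|[pred z : G | adj x z]|%:R.

Definition lamplighter_walk (R : realType) (V : finType) (q : V -> V -> R)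
    (u v : {ffun V -> bool} * V) : R :=
  let: (f, a) := u in
  let: (h, b) := v in
  if a == b then
    if [forall z, (z != a) ==> (f z == h z)] then q a a / 2 else 0
  else
    if [forall z, (z != a) && (z != b) ==> (f z == h z)] then q a b / 4 else 0.

(* Main.v *)
(* Once the base walk has covered the graph the lamps are exactly uniform, so the
   lamplighter walk is mixed at time t up to P(cover time > t) plus the distance
   of the base walk to equilibrium. Conversely, if K sqrt(N) of the N vertices
   are unvisited then the number of lamps that are on is atypical. So if the
   lamplighter walk is eps-mixed at time t, then with probability bounded below,
   from every starting point, a run of length t misses O(sqrt N) vertices; by
   transitivity two independent runs, the second from a well-chosen vertex, miss
   only O(1) common vertices, and these are hit within O(t_hit) further steps.
   Hence the cover time is at most 2 t + O(t_hit) with probability bounded below.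

   The variance of the cover time is at most 2 t_hit E[C]: with h(x, U) the
   expected time to visit U from x and m(U) = max_x h(x, U), the function
   2 h m - m^2 + 2 t_hit m is a supersolution of the first step equation for the
   second moment. This gives concentration when t_hit = o(E[C]).

   The base walk mixes in time O(t_hit) although it is not lazy. Hitting times on
   the bipartite double cover are O(t_hit): otherwise the most likely parity of
   the time needed to go from x to y would be an invariant +-1 cocycle, which is
   a parity of the graph violated independently at each step with a probability
   kappa >= 1/N (by aperiodicity), and O(N) steps would lose the parity. On the
   double cover p^2t(x,x) is then bounded through the number of returns to x,
   because p^2t(x,x) + p^(2t+1)(x,x) decreases in t. *)

Require Import Defs.
From mathcomp Require Import all_boot all_order all_fingroup all_algebra.
From mathcomp Require Import all_classical all_reals all_analysis.
From mathcomp Require Import ring lra zify.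

Set Implicit Arguments.
Unset Strict Implicit.
Unset Printing Implicit Defensive.

Import Order.TTheory GRing.Theory Num.Theory.
Import numFieldNormedType.Exports.

Local Open Scope ring_scope.

(** * Expectations over finite trajectories *)

Section Expectation.
Variables (R : realType) (S : finType) (p : S -> S -> R).
Implicit Types (F H : seq S -> R) (x y z : S) (U : {set S}) (n m : nat).

(* The expectation of F (X_1, ..., X_n) for the walk started at X_0 = x. *)
Fixpoint Ex n x F : R :=
  if n is n'.+1 then \sum_y p x y * Ex n' y (fun w => F (y :: w)) else F [::].

Lemma eq_Ex n x F H :
  (forall w, size w = n -> F w = H w) -> Ex n x F = Ex n x H.
Proof.
elim: n x F H => [|n IH] x F H FH /=; first exact: FH.
by apply: eq_bigr => y _; congr (_ * _); apply: IH => w sw; apply: FH; rewrite /= sw.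
Qed.

Lemma ExD n x F H : Ex n x (fun w => F w + H w) = Ex n x F + Ex n x H.
Proof.
elim: n x F H => [|n IH] x F H //=.
by rewrite -big_split; apply: eq_bigr => y _; rewrite IH mulrDr.
Qed.

Lemma ExZ n x a F : Ex n x (fun w => a * F w) = a * Ex n x F.
Proof.
elim: n x F => [|n IH] x F //=.
by rewrite mulr_sumr; apply: eq_bigr => y _; rewrite IH mulrCA.
Qed.

Lemma ExB n x F H : Ex n x (fun w => F w - H w) = Ex n x F - Ex n x H.
Proof.
rewrite ExD; congr (_ + _); rewrite -mulN1r -ExZ.
by apply: eq_Ex => w _; rewrite mulN1r.
Qed.

Lemma Ex0 n x : Ex n x (fun=> 0) = 0.
Proof.
transitivity (Ex n x (fun=> 0 * 0)); first by apply: eq_Ex => w _; rewrite mul0r.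
by rewrite ExZ mul0r.
Qed.

Lemma Ex_sum (I : finType) n x (F : I -> seq S -> R) :
  Ex n x (fun w => \sum_i F i w) = \sum_i Ex n x (F i).
Proof.
elim: n x F => [|n IH] x F //=.
under eq_bigr do rewrite IH mulr_sumr.
by rewrite exchange_big.
Qed.

Lemma Ex_cat n m x F :
  Ex (n + m) x F = Ex n x (fun w => Ex m (last x w) (fun w' => F (w ++ w'))).
Proof.
by elim: n x F => [|n IH] x F //=; apply: eq_bigr => y _; rewrite IH.
Qed.

Lemma step_probE n x y : step_prob p n x y = Ex n x (fun w => (last x w == y)%:R).
Proof. by elim: n x => [|n IH] x //=; apply: eq_bigr => z _; rewrite IH. Qed.

Lemma Ex_last n x (g : S -> R) :
  Ex n x (fun w => g (last x w)) = \sum_y step_prob p n x y * g y.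
Proof.
elim: n x => [|n IH] x /=.
  rewrite (bigD1 x) //= eqxx mul1r big1 ?addr0 // => y.
  by rewrite eq_sym => /negbTE->; rewrite mul0r.
under eq_bigr do rewrite IH mulr_sumr.
rewrite exchange_big /=; apply: eq_bigr => y _; rewrite mulr_suml.
by apply: eq_bigr => z _; rewrite mulrA.
Qed.

Lemma step_probD n m x y :
  step_prob p (n + m) x y = \sum_z step_prob p n x z * step_prob p m z y.
Proof.
rewrite step_probE Ex_cat -(Ex_last n x (fun z => step_prob p m z y)).
apply: eq_Ex => w _; rewrite step_probE; apply: eq_Ex => w' _.
by rewrite last_cat.
Qed.

(** Bridge from the sums over tuples in the definition of first times to the recursive [Ex], whose
    shape suits first step analysis. *)
Lemma Ex_path_prob n x (Q : pred (seq S)) :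
  \sum_(w : n.-tuple S | Q w) path_prob p x w = Ex n x (fun w => (Q w)%:R).
Proof.
rewrite big_mkcond; elim: n x Q => [|n IH] x Q.
  rewrite (big_pred1 [tuple]) /=; last by move=> w; apply/esym/eqP/tuple0.
  by case: (Q _).
rewrite (reindex (fun yw : S * n.-tuple S => [tuple of yw.1 :: yw.2])) /=; last first.
  exists (fun w : n.+1.-tuple S => (thead w, [tuple of behead w])) => [[y w]|w] _ /=.
    by rewrite theadE; congr pair; apply: val_inj.
  by rewrite -tuple_eta.
rewrite -(pair_bigA _ (fun y (w : n.-tuple S) =>
  if Q (y :: w) then p x y * path_prob p y w else 0)) /=.
apply: eq_bigr => y _; rewrite -IH mulr_sumr.
by apply: eq_bigr => w _; case: ifP; rewrite ?mulr0.
Qed.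

Lemma Ex_aut (s : S -> S) (s_p : forall x y, p (s x) (s y) = p x y)
    (s_bij : bijective s) n x F :
  Ex n (s x) F = Ex n x (fun w => F (map s w)).
Proof.
elim: n x F => [|n IH] x F //=.
rewrite (reindex s) /=; last exact: onW_bij.
by apply: eq_bigr => y _; rewrite s_p IH.
Qed.

Hypothesis p_ge0 : forall x y, 0 <= p x y.
Hypothesis p_sum1 : forall x, \sum_y p x y = 1.

Lemma ler_Ex n x F H :
  (forall w, size w = n -> F w <= H w) -> Ex n x F <= Ex n x H.
Proof.
elim: n x F H => [|n IH] x F H FH /=; first exact: FH.
by apply: ler_sum => y _; rewrite ler_wpM2l //; apply: IH => w sw; apply: FH; rewrite /= sw.
Qed.

Lemma Ex_ge0 n x F : (forall w, size w = n -> 0 <= F w) -> 0 <= Ex n x F.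
Proof. by move=> F0; rewrite -(Ex0 n x) ler_Ex. Qed.

Lemma Ex_cst n x a : Ex n x (fun=> a) = a.
Proof.
elim: n x => [|n IH] x //=.
by under eq_bigr do rewrite IH; rewrite -mulr_suml p_sum1 mul1r.
Qed.

Lemma Ex_take n m x F : Ex (n + m) x (fun w => F (take n w)) = Ex n x F.
Proof.
rewrite Ex_cat; apply: eq_Ex => w sw.
rewrite -[RHS](Ex_cst m (last x w)); apply: eq_Ex => w' _.
by rewrite -sw take_size_cat.
Qed.

Lemma step_prob_ge0 n x y : 0 <= step_prob p n x y.
Proof. by rewrite step_probE; apply: Ex_ge0. Qed.

Lemma step_prob_sum1 n x : \sum_y step_prob p n x y = 1.
Proof.
under eq_bigr do rewrite -[step_prob _ _ _ _]mulr1.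
by rewrite -(Ex_last n x (fun=> 1)) Ex_cst.
Qed.

Lemma step_prob_sym : (forall x y, p x y = p y x) ->
  forall n x y, step_prob p n x y = step_prob p n y x.
Proof.
move=> p_sym; elim=> [|n IH] x y; first by rewrite /= eq_sym.
rewrite -[in RHS](addn1 n) step_probD /=; apply: eq_bigr => z _.
rewrite IH mulrC p_sym; congr (_ * _).
rewrite (bigD1 x) //= eqxx mulr1 big1 ?addr0 // => u /negbTE.
by move=> ->; rewrite mulr0.
Qed.

End Expectation.

(** * Cover times *)

Lemma bernoulli (R : realType) (a : R) j : 0 <= a -> 1 + a * j%:R <= (1 + a) ^+ j.
Proof.
move=> a0; elim: j => [|j IH]; first by rewrite mulr0 addr0 expr0.
rewrite exprS -natr1; have j0 : 0 <= j%:R :> R by rewrite ler0n.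
apply: (@le_trans _ _ ((1 + a) * (1 + a * j%:R))); last by rewrite ler_wpM2l // addr_ge0.
nra.
Qed.

Section Cover.
Variables (R : realType) (S : finType) (p : S -> S -> R).
Implicit Types (x y z : S) (U V : {set S}) (n m : nat).

(* With tau the time needed to visit all of U (the starting point counts as
   visited): P_x(tau <= n), P_x(tau > n), E_x[min(tau, n)] and E_x[tau]. *)
Definition cv n x U : R := Ex p n x (fun w => (U \subset x :: w)%:R).
Definition tl n x U : R := 1 - cv n x U.
Definition hs n x U : R := \sum_(0 <= k < n) tl k x U.
Definition ht x U : R := limn (fun n => hs n x U).

Lemma sub_consD1 U x (w : seq S) : (U \subset x :: w) = (U :\ x \subset w).
Proof.
apply/fintype.subsetP/fintype.subsetP => sU y.
  by rewrite !inE => /andP[yx /sU]; rewrite inE (negbTE yx).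
by move=> yU; rewrite inE; case: eqVneq => //= yx; apply: sU; rewrite !inE yx.
Qed.

Lemma cv1E n x y : cv n x [set y] = Ex p n x (fun w => (y \in x :: w)%:R).
Proof.
apply: eq_Ex => w _; congr (_%:R); congr (nat_of_bool _).
apply/fintype.subsetP/idP => [/(_ y)|yw z]; rewrite finset.in_set1.
  by rewrite eqxx; apply.
by move=> /eqP ->.
Qed.

Lemma cv0 x U : cv 0 x U = (U :\ x == finset.set0)%:R.
Proof.
rewrite /cv /= sub_consD1 -finset.subset0; congr (_%:R); congr (nat_of_bool _).
by apply/fintype.subsetP/fintype.subsetP
  => sU y /sU; rewrite !inE.
Qed.

(** First step analysis: the current vertex is struck off the target, so the set still to be visited
    carries all the memory of the past. *)
Lemma cvS n x U : cv n.+1 x U = \sum_y p x y * cv n y (U :\ x).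
Proof. by apply: eq_bigr => y _; congr (_ * _); apply: eq_Ex => w _; rewrite sub_consD1. Qed.

Lemma cvD1 n x U : cv n x (U :\ x) = cv n x U.
Proof.
apply: eq_Ex => w _; rewrite !sub_consD1 (_ : U :\ x :\ x = U :\ x) //.
by apply/setP => y; rewrite !inE; case: eqP.
Qed.

Lemma tlD1 n x U : tl n x (U :\ x) = tl n x U.
Proof. by rewrite /tl cvD1. Qed.

Lemma tl0 x U : tl 0 x U = (U :\ x != finset.set0)%:R.
Proof. by rewrite /tl cv0; case: eqP; rewrite ?subrr ?subr0. Qed.

Lemma cv_aut (s : S -> S) (s_bij : bijective s)
    (s_p : forall x y, p (s x) (s y) = p x y) n x U :
  cv n (s x) (s @: U) = cv n x U.
Proof.
rewrite /cv (Ex_aut s_p) //.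
apply: eq_Ex => w _; congr (_%:R); rewrite -map_cons; congr (nat_of_bool _).
apply/fintype.subsetP/fintype.subsetP => sU y.
  by move=> yU; rewrite -(mem_map (bij_inj s_bij)) sU // imset_f.
by case/imsetP => z zU ->; rewrite mem_map ?sU //; exact: bij_inj s_bij.
Qed.

Lemma cv_aut1 (s : S -> S) (s_bij : bijective s)
    (s_p : forall x y, p (s x) (s y) = p x y) n x y :
  cv n (s x) [set s y] = cv n x [set y].
Proof. by rewrite -[RHS](cv_aut s_bij s_p) imset_set1. Qed.

Hypothesis p_ge0 : forall x y, 0 <= p x y.
Hypothesis p_sum1 : forall x, \sum_y p x y = 1.

Lemma cv_ge0 n x U : 0 <= cv n x U.
Proof. exact: Ex_ge0. Qed.

Lemma cv_le1 n x U : cv n x U <= 1.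
Proof.
rewrite -[leRHS](Ex_cst p_sum1 n x); apply: ler_Ex => // w _.
by rewrite lern1 leq_b1.
Qed.

Lemma tl_ge0 n x U : 0 <= tl n x U.
Proof. by rewrite subr_ge0 cv_le1. Qed.

Lemma tl_le1 n x U : tl n x U <= 1.
Proof. by rewrite /tl lerBlDr lerDl cv_ge0. Qed.

Lemma tlS n x U : tl n.+1 x U = \sum_y p x y * tl n y (U :\ x).
Proof.
rewrite /tl cvS -[in LHS](p_sum1 x) -sumrB.
by apply: eq_bigr => y _; rewrite mulrBr mulr1.
Qed.

Lemma tlE n x U : tl n x U = Ex p n x (fun w => (~~ (U \subset x :: w))%:R).
Proof.
rewrite /tl -[1 in LHS](Ex_cst p_sum1 n x) -ExB; apply: eq_Ex => w _.
by case: (_ \subset _); rewrite ?subrr ?subr0.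
Qed.

Lemma cv_set0 n x : cv n x finset.set0 = 1.
Proof.
rewrite -[RHS](Ex_cst p_sum1 n x); apply: eq_Ex => w _.
by rewrite (_ : _ \subset _) //; apply/fintype.subsetP => y; rewrite inE.
Qed.

Lemma ler_nat_bool (a b : bool) : (a -> b) -> a%:R <= b%:R :> R.
Proof. by case: a; case: b => // /(_ isT). Qed.

Lemma cv_homo n m x U : (n <= m)%N -> cv n x U <= cv m x U.
Proof.
move=> /subnKC <-; rewrite /cv -(Ex_take p_sum1 n (m - n)).
apply: ler_Ex => // w _; apply: ler_nat_bool => /fintype.subsetP sU.
apply/fintype.subsetP => y /sU; rewrite !inE => /orP[->//|/mem_take ->].
by rewrite orbT.
Qed.

Lemma tl_nincr n m x U : (n <= m)%N -> tl m x U <= tl n x U.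
Proof. by move=> nm; rewrite lerB // cv_homo. Qed.

Lemma cv_subset n x U V : U \subset V -> cv n x V <= cv n x U.
Proof. by move=> UV; apply: ler_Ex => // w _; apply: ler_nat_bool; apply: fintype.subset_trans. Qed.

(* Strong Markov property at the hitting time of B. *)
Lemma cv_markov (B : pred S) n m x U c : 0 <= c ->
  (forall z, B z -> c <= cv m z U) ->
  c * Ex p n x (fun w => (has B (x :: w))%:R) <= cv (n + m) x U.
Proof.
move=> c0 Bc; elim: n x U Bc => [|n IH] x U Bc.
  by rewrite /=; case: (boolP (B x)) => [/Bc|] //=; rewrite ?mulr1 ?mulr0 // cv_ge0.
case: (boolP (B x)) => Bx.
  apply: (@le_trans _ _ c).
    rewrite -[leRHS]mulr1 ler_wpM2l // -[leRHS](Ex_cst p_sum1 n.+1 x).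
    by apply: ler_Ex => // w _; rewrite lern1 leq_b1.
  by apply: (le_trans (Bc _ Bx)); apply: cv_homo; rewrite leq_addl.
rewrite addSn cvS /= mulr_sumr; apply: ler_sum => y _.
rewrite mulrCA ler_wpM2l // -(@eq_Ex _ _ _ _ _ (fun w => (has B (y :: w))%:R)); last first.
  by move=> w _; rewrite (negbTE Bx).
by apply: IH => z Bz; apply: (le_trans (Bc _ Bz)); apply: cv_subset; exact: finset.subD1set.
Qed.

Lemma cv_markov1 n m x y U : cv n x [set y] * cv m y U <= cv (n + m) x U.
Proof.
have By z : pred1 y z -> cv m y U <= cv m z U by move=> /eqP->.
rewrite mulrC; apply: le_trans (cv_markov n x (cv_ge0 _ _ _) By).
rewrite ler_wpM2l ?cv_ge0 // cv1E; apply: ler_Ex => // w _.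
by rewrite has_pred1.
Qed.

(** The vertices of U are sought one after another; each search takes n steps and succeeds with
    probability at least c from any position. *)
Lemma cv_iter c n U x : 0 <= c -> (forall x y, c <= cv n x [set y]) ->
  c ^+ #|U| <= cv (#|U| * n) x U.
Proof.
move=> c0 nc; have [k] := ubnP #|U|; elim: k U x => // k IH U x.
rewrite ltnS => Uk; have [->|[y yU]] := finset.set_0Vmem U.
  by rewrite cards0 cv_set0.
rewrite (cardsD1 y) yU add1n exprS mulSn.
apply: le_trans (cv_markov1 _ _ _ y _); rewrite ler_pM ?exprn_ge0 //.
by rewrite -[cv _ _ U]cvD1; apply: IH; move: Uk; rewrite (cardsD1 y U) yU add1n.
Qed.

Lemma cv_refl n x : cv n x [set x] = 1.
Proof.
rewrite -cvD1 (_ : _ :\ _ = finset.set0) ?cv_set0 //.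
by apply/setP => y; rewrite !inE andNb.
Qed.

Lemma cv_step_prob n m x U :
  \sum_z step_prob p n x z * cv m z U <= cv (n + m) x U.
Proof.
rewrite -(Ex_last p n x (fun z => cv m z U)) /cv Ex_cat; apply: ler_Ex => // w _.
apply: ler_Ex => // w' _; apply: ler_nat_bool => /fintype.subsetP sU.
apply/fintype.subsetP => y /sU; rewrite -cat_cons mem_cat !inE => /orP[/eqP->|->].
  by have := mem_last x w; rewrite inE => ->.
by rewrite orbT.
Qed.

Lemma sum_cv_le n x : \sum_y cv n x [set y] <= n.+1%:R.
Proof.
under eq_bigr do rewrite cv1E.
rewrite -Ex_sum -[leRHS](Ex_cst p_sum1 n x); apply: ler_Ex => // w sw.
rewrite -natr_sum ler_nat -sw -[(size w).+1]/(size (x :: w)).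
apply: leq_trans (card_size (x :: w)); rewrite -sum1_card [leqRHS]big_mkcond /=.
by apply: leq_sum => y _; case: (_ \in _).
Qed.

(** At time n the walk is restarted and must visit all of U anew, which is harder than completing
    the visit. *)
Lemma tlD n m x U a : (forall z, tl m z U <= a) -> tl (n + m) x U <= tl n x U * a.
Proof.
move=> za; rewrite !tlE Ex_cat mulrC -ExZ; apply: ler_Ex => // w _.
case: (boolP (U \subset x :: w)) => Uw.
  rewrite mulr0 -(Ex0 p m (last x w)); apply: ler_Ex => // w' _.
  rewrite (_ : _ \subset _) //; apply: fintype.subset_trans Uw _.
  by apply/fintype.subsetP => y; rewrite !inE mem_cat => /orP[->//|->]; rewrite orbT.
rewrite mulr1; apply: le_trans (za (last x w)); rewrite tlE.
apply: ler_Ex => // w' _; apply: ler_nat_bool; apply: contra => /fintype.subsetP sU.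
apply/fintype.subsetP => y /sU; rewrite -cat_cons mem_cat !inE => /orP[/eqP->|->].
  by have := mem_last x w; rewrite inE => ->.
by rewrite orbT.
Qed.

Lemma tl_geom c n k x U : (forall z, c <= cv n z U) -> tl (k * n) x U <= (1 - c) ^+ k.
Proof.
move=> nc; elim: k => [|k IH]; first by rewrite expr0 tl_le1.
have c1 : c <= 1 by apply: le_trans (nc x) (cv_le1 _ _ _).
rewrite mulSn addnC exprSr; apply: (@le_trans _ _ (tl (k * n) x U * (1 - c))).
  by apply: tlD => z; rewrite lerB.
by rewrite ler_wpM2r // subr_ge0.
Qed.

Lemma hsS n x U : hs n.+1 x U = hs n x U + tl n x U.
Proof. by rewrite /hs big_nat_recr. Qed.

Lemma hs0 x U : hs 0 x U = 0.
Proof. by rewrite /hs big_geq. Qed.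

Lemma hs_step n x U : hs n.+1 x U = tl 0 x U + \sum_y p x y * hs n y (U :\ x).
Proof.
rewrite /hs big_nat_recl //; congr (_ + _).
under eq_bigr do rewrite tlS.
by rewrite exchange_big /=; apply: eq_bigr => y _; rewrite mulr_sumr.
Qed.

Lemma hsD1 n x U : hs n x (U :\ x) = hs n x U.
Proof. by apply: eq_bigr => k _; rewrite tlD1. Qed.

Lemma hs_homo x U : nondecreasing_seq (fun n => hs n x U).
Proof. by apply/nondecreasing_seqP => n; rewrite hsS lerDl tl_ge0. Qed.

Lemma hs_le n x U : hs n x U <= n%:R.
Proof.
rewrite /hs (@le_trans _ _ (\sum_(0 <= k < n) 1)) //; last first.
  by rewrite big_const_nat subn0 iter_addr_0.
by apply: ler_sum => k _; exact: tl_le1.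
Qed.

(** Blocks of n steps are trials with success probability at least c; n / c is the fixed point of b
    = n + (1 - c) b. *)
Lemma hs_bound c n m x U : 0 < c -> (forall z, c <= cv n z U) -> hs m x U <= n%:R / c.
Proof.
move=> c0 nc; have c1 : c <= 1 by apply: le_trans (nc x) (cv_le1 _ _ _).
have step k : hs (k * n) x U <= n%:R / c.
  elim: k => [|k IH]; first by rewrite mul0n hs0 divr_ge0 // ltW.
  rewrite mulSn /hs (@big_cat_nat _ _ _ n) ?leq_addr //=.
  apply: (@le_trans _ _ (n%:R + (1 - c) * hs (k * n) x U)).
    apply: lerD; first exact: hs_le.
    rewrite -{1}[n]add0n big_addn addKn /hs mulr_sumr.
    apply: ler_sum => j _; rewrite mulrC; apply: tlD => z; exact: lerB.
  apply: (@le_trans _ _ (n%:R + (1 - c) * (n%:R / c))).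
    by rewrite lerD2l ler_wpM2l // subr_ge0.
  by rewrite le_eqVlt; apply/orP; left; apply/eqP; field; rewrite gt_eqF.
(* Blocks of length 0 do not exhaust time, but then c > 0 forces U to be visited at time 0. *)
case: (posnP n) => [n0|n0].
  have tl00 k : tl k x U <= 0.
    apply: (@le_trans _ _ (tl 0 x U)); first exact: tl_nincr.
    have := nc x; rewrite n0 /tl cv0; case: (_ == _); rewrite ?subrr // => h.
    by have := lt_le_trans c0 h; rewrite ltxx.
  by rewrite n0 mul0r; apply: sumr_le0 => k _.
apply: le_trans (step m); apply: hs_homo; exact: leq_pmulr.
Qed.

Lemma hs_subset n x U V : U \subset V -> hs n x U <= hs n x V.
Proof. by move=> UV; apply: ler_sum => k _; rewrite lerB // cv_subset. Qed.

End Cover.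

(** * Concentration of cover times *)

Section ExpectedCover.
Variables (R : realType) (S : finType) (p : S -> S -> R).
Implicit Types (x y z : S) (U V : {set S}) (n m : nat).
Hypothesis p_ge0 : forall x y, 0 <= p x y.
Hypothesis p_sum1 : forall x, \sum_y p x y = 1.
Hypothesis hs_bounded : forall x U, exists B, forall n, hs p n x U <= B.

Local Notation cv := (cv p).
Local Notation tl := (tl p).
Local Notation hs := (hs p).
Local Notation ht := (ht p).

Lemma cvg_hs x U : ((fun n => hs n x U) @ \oo --> ht x U)%classic.
Proof.
have [B hB] := hs_bounded x U.
apply: nondecreasing_is_cvgn; first exact: hs_homo.
by exists B => _ [n _ <-].
Qed.

Lemma hs_le_ht n x U : hs n x U <= ht x U.
Proof. by apply: nondecreasing_cvgn_le; [exact: hs_homo|exact: cvg_hs]. Qed.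

Lemma ht_le x U B : (forall n, hs n x U <= B) -> ht x U <= B.
Proof. by move=> hB; apply: limr_le; [exact: cvg_hs|exact: nearW]. Qed.

Lemma ht_ge0 x U : 0 <= ht x U.
Proof. by rewrite -(hs0 p x U) hs_le_ht. Qed.

Lemma htD1 x U : ht x (U :\ x) = ht x U.
Proof. by congr (limn _); apply/funext => n; rewrite hsD1. Qed.

Lemma ht_subset x U V : U \subset V -> ht x U <= ht x V.
Proof.
by move=> UV; apply: ht_le => n; apply: le_trans (hs_le_ht n x V); exact: hs_subset.
Qed.

Lemma ht_step x U : ht x U = tl 0 x U + \sum_y p x y * ht y (U :\ x).
Proof.
have h1 : ((fun n => hs n.+1 x U) @ \oo --> ht x U)%classic.
  by move: (@cvg_hs x U); rewrite -(cvg_shiftS (fun n => hs n x U)).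
apply/esym; apply: (cvg_unique _ _ h1) => //.
rewrite (_ : (fun n => hs n.+1 x U) =
  (fun n => tl 0 x U + \sum_y p x y * hs n y (U :\ x))); last first.
  by apply/funext => n; rewrite hs_step.
apply: cvgD; first exact: cvg_cst.
apply: cvg_big => [|y _]; first exact: add_continuous.
by apply: cvgMl_tmp; exact: cvg_hs.
Qed.

(** Going to x first and then visiting U from there is one way to visit U. The induction is on the
    truncation level; striking vertices off U on the way only shortens the task. *)
Lemma ht_sub z x U : ht z U <= ht z [set x] + ht x U.
Proof.
apply: ht_le => n; elim: n z U => [|n IH] z U.
  by rewrite hs0 addr_ge0 // ht_ge0.
have [->|zx] := eqVneq z x.
  by apply: (le_trans (hs_le_ht _ _ _)); rewrite lerDr ht_ge0.
have xz : [set x] :\ z = [set x].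
  by apply/setP => y; rewrite !inE; case: eqP => //= ->; rewrite (negbTE zx).
rewrite hs_step // (ht_step z [set x]) -[leRHS]addrA; apply: lerD.
  rewrite [leRHS]tl0 xz (_ : _ != _) ?tl_le1 //.
  by apply/set0Pn; exists x; rewrite inE.
rewrite xz -[ht x U]mul1r -(p_sum1 z) mulr_suml -big_split /=.
apply: ler_sum => y _; rewrite -mulrDr ler_wpM2l //.
apply: (le_trans (hs_subset p_ge0 n y (finset.subD1set U z))); exact: IH.
Qed.

(** Markov's inequality in tail form: the tails decrease, so each of the first n + 1 is at least the
    last. *)
Lemma tl_markov n x U : n.+1%:R * tl n x U <= ht x U.
Proof.
apply: le_trans (hs_le_ht n.+1 x U).
rewrite /hs mulr_natl -[in leLHS](subn0 n.+1) -iter_addr_0 -big_const_nat /=.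
by rewrite big_nat [leRHS]big_nat; apply: ler_sum => k /andP[_ kn]; exact: tl_nincr.
Qed.

Definition hmax U : R := \big[Num.max/0]_x ht x U.

Lemma ht_hmax x U : ht x U <= hmax U.
Proof. exact: (le_bigmax 0 (fun x => ht x U)). Qed.

Lemma hmax_ge0 U : 0 <= hmax U.
Proof. exact: bigmax_ge_id. Qed.

Lemma hmax_le U B : 0 <= B -> (forall x, ht x U <= B) -> hmax U <= B.
Proof. by move=> B0 hB; apply: bigmax_le. Qed.

Variable T : R.
Hypothesis ht_T : forall x y, ht x [set y] <= T.

Lemma T_ge0 (x : S) : 0 <= T.
Proof. exact: le_trans (ht_ge0 x [set x]) (ht_T x x). Qed.

Lemma hmax_ht x U : hmax U <= T + ht x U.
Proof.
apply: hmax_le => [|z]; first by rewrite addr_ge0 ?ht_ge0 // (T_ge0 x).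
by apply: (le_trans (ht_sub z x U)); rewrite lerD2r.
Qed.

(** E_x[min(tau, n)^2], because k^2 is the sum of the first k odd numbers. *)
Definition ws n x U : R := \sum_(0 <= k < n) (k.*2.+1)%:R * tl k x U.

Lemma ws_step n x U :
  ws n.+1 x U = tl 0 x U + \sum_y p x y * (ws n y (U :\ x) + 2 * hs n y (U :\ x)).
Proof.
rewrite /ws big_nat_recl // mul1r; congr (_ + _).
under [RHS]eq_bigr do rewrite /hs mulr_sumr -big_split mulr_sumr /=.
rewrite [RHS]exchange_big /=; apply: eq_bigr => k _.
rewrite tlS // mulr_sumr; apply: eq_bigr => y _.
by rewrite doubleS -addn2 natrD; ring.
Qed.

(* The bound on E_x[tau_U^2] is a supersolution of the first step equation;
   the term 2 T hmax pays for the drop of [hmax] when a vertex of U is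
   visited, which is at most T. *)
Lemma ws_le n x U :
  ws n x U <= 2 * ht x U * hmax U - hmax U ^+ 2 + 2 * T * hmax U.
Proof.
have psi_ge0 y V : 0 <= 2 * ht y V * hmax V - hmax V ^+ 2 + 2 * T * hmax V.
  have := hmax_ht y V; have := hmax_ge0 V; have := ht_ge0 y V; have := T_ge0 y.
  nra.
elim: n x U => [|n IH] x U; first by rewrite /ws big_geq.
have [U0|U0] := eqVneq (U :\ x) finset.set0.
  rewrite (_ : ws _ _ _ = 0) // /ws big1 // => k _.
  by rewrite -tlD1 U0 /tl cv_set0 // subrr mulr0.
set V := U :\ x in U0 *.
have htS : \sum_y p x y * ht y V = ht x U - 1.
  by rewrite (ht_step x U) tl0 -/V U0 /= addrC addrA addNr add0r.
apply: (@le_trans _ _ (1 + \sum_y p x y *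
   (2 * ht y V * hmax V - hmax V ^+ 2 + 2 * T * hmax V + 2 * ht y V))).
  rewrite ws_step; apply: lerD; [exact: tl_le1|apply: ler_sum] => y _.
  by rewrite ler_wpM2l // lerD ?IH // ler_wpM2l // hs_le_ht.
have -> : \sum_y p x y *
   (2 * ht y V * hmax V - hmax V ^+ 2 + 2 * T * hmax V + 2 * ht y V) =
   (2 * hmax V + 2) * (ht x U - 1) + (2 * T * hmax V - hmax V ^+ 2).
  rewrite -htS -[X in _ + X]mul1r -(p_sum1 x) mulr_sumr mulr_suml -big_split /=.
  by apply: eq_bigr => y _; ring.
have hV : ht x V = ht x U by exact: htD1.
have := ht_hmax x V; have := hmax_ht x U; have := hmax_ht x V.
have VU : hmax V <= hmax U.
  apply: hmax_le => [|y]; first exact: hmax_ge0.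
  by apply: le_trans (ht_hmax y U); apply: ht_subset; exact: finset.subD1set.
have := hmax_ge0 V; have := ht_ge0 x U; have := T_ge0 x; rewrite hV.
move: (ht x U) (hmax U) (hmax V) VU => h M M' MM' T0 h0 M'0 hM hM' hM''.
(* Here h = [ht x U], M = [hmax U] and M' = [hmax V]. Both M and M' are at most h + T, and h <= M'
   takes care of the linear terms. *)
have : 0 <= (M - M') * (2 * h - M - M' + 2 * T) by apply: mulr_ge0; lra.
nra.
Qed.

(* By Abel summation this is E_x[(min(tau, n) - c)^2]. *)
Definition dev n x U (c : R) : R := c ^+ 2 + ws n x U - 2 * c * hs n x U.

Lemma devS n x U c :
  dev n.+1 x U c = dev n x U c + tl n x U * ((n.+1%:R - c) ^+ 2 - (n%:R - c) ^+ 2).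
Proof.
have n2 : n.*2.+1%:R = 2 * n%:R + 1 :> R by rewrite -addn1 natrD -mul2n natrM.
by rewrite /dev /ws hsS // big_nat_recr //= n2 -natr1; ring.
Qed.

(** The contribution of the event tau > n, on which min(tau, n) = n. *)
Lemma dev_tl n x U c : tl n x U * (n%:R - c) ^+ 2 <= dev n x U c.
Proof.
elim: n => [|n IH].
  rewrite /dev /ws big_geq // hs0 mulr0 subr0 addr0 sub0r sqrrN.
  by rewrite ler_piMl ?sqr_ge0 // tl_le1.
apply: (@le_trans _ _ (tl n x U * (n.+1%:R - c) ^+ 2)).
  by rewrite ler_wpM2r ?sqr_ge0 // tl_nincr.
by rewrite devS mulrBr -lerBlDr opprB addrCA subrr addr0.
Qed.

(** The truncation level tends to infinity: [hs] converges to [ht], and [ws] is replaced by its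
    bound from [ws_le]. *)
Lemma dev_lim_le x U n c (a : R) :
  (forall k, (n <= k)%N -> a <= dev k x U c) ->
  a <= c ^+ 2 - 2 * c * ht x U + (2 * ht x U * hmax U - hmax U ^+ 2 + 2 * T * hmax U).
Proof.
move=> an.
have cv2 : ((fun k => c ^+ 2 - 2 * c * hs k x U +
    (2 * ht x U * hmax U - hmax U ^+ 2 + 2 * T * hmax U)) @ \oo -->
    c ^+ 2 - 2 * c * ht x U + (2 * ht x U * hmax U - hmax U ^+ 2 + 2 * T * hmax U))%classic.
  apply: cvgD; last exact: cvg_cst.
  by apply: cvgB; [exact: cvg_cst|apply: cvgMl_tmp; exact: cvg_hs].
rewrite -(cvg_lim _ cv2) //; apply: limr_ge; first by apply: cvgP cv2.
exists n => // k /= nk; apply: (le_trans (an k nk)).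
by rewrite /dev addrAC lerD2l ws_le.
Qed.

(** At c = [ht x U] the bound of [dev_lim_le] equals 2 T hmax - (ht - hmax)^2, so 2 T hmax bounds
    the variance. *)
Lemma var_le x U :
  ht x U ^+ 2 - 2 * ht x U * ht x U +
  (2 * ht x U * hmax U - hmax U ^+ 2 + 2 * T * hmax U) <= 2 * T * hmax U.
Proof. have := sqr_ge0 (ht x U - hmax U); nra. Qed.

(** Past the mean, [dev] is nondecreasing in the truncation level, so the contribution of tau > n
    survives in the limit. *)
Lemma chebyshev_upper n x U : ht x U <= n%:R ->
  tl n x U * (n%:R - ht x U) ^+ 2 <= 2 * T * hmax U.
Proof.
move=> hn; apply: le_trans (var_le x U); apply: (@dev_lim_le x U n) => k nk.
apply: (le_trans (dev_tl n x U _)); rewrite -(subnKC nk).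
elim: (k - n)%N => [|j IH]; first by rewrite addn0.
rewrite addnS devS; apply: (le_trans IH); rewrite lerDl mulr_ge0 ?tl_ge0 //.
have : n%:R <= (n + j)%:R :> R by rewrite ler_nat leq_addr.
by rewrite -[(n + j).+1]addn1 [in (_ + 1)%:R]natrD; nra.
Qed.

(** If tau <= n and n is below the mean, min(tau, k) stays at distance at least ht - n from the mean
    for all k >= n. *)
Lemma chebyshev_lower n x U : n%:R <= ht x U ->
  cv n x U * (n%:R - ht x U) ^+ 2 <= 2 * T * hmax U.
Proof.
move=> hn; apply: le_trans (var_le x U); apply: (@dev_lim_le x U n) => k nk.
set c := ht x U in hn *.
have base j : j%:R <= c -> (j%:R - c) ^+ 2 <= dev j x U c.
  elim: j => [|j IH] jc.
    by rewrite /dev /ws big_geq // hs0 mulr0 subr0 addr0 sub0r sqrrN.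
  have j1 : j.+1%:R = j%:R + 1 :> R by rewrite -addn1 natrD.
  rewrite devS; have : (j%:R - c) ^+ 2 <= dev j x U c by apply: IH; lra.
  by rewrite j1 in jc *; have := tl_le1 p_ge0 j x U; have := tl_ge0 p_ge0 p_sum1 j x U; nra.
(* The tail term makes the induction on k close; at k = n the two terms add up to (n - c)^2, which
   is [base]. *)
suff : cv n x U * (n%:R - c) ^+ 2 + tl k x U * (k%:R - c) ^+ 2 <= dev k x U c.
  by apply: le_trans; rewrite lerDl mulr_ge0 ?sqr_ge0 ?tl_ge0.
rewrite -(subnKC nk); elim: (k - n)%N => [|j IH].
  by rewrite addn0 -mulrDl /tl addrCA subrr addr0 mul1r base.
rewrite addnS devS; apply: le_trans (lerD IH (lexx _)).
rewrite -addrA lerD2l mulrBr addrCA subrr addr0 ler_wpM2r ?sqr_ge0 //.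
by rewrite tl_nincr.
Qed.

End ExpectedCover.

(** * First passage times as limits *)

Section FirstTime.
Variables (R : realType) (S : finType) (p : S -> S -> R).
Implicit Types (x y z : S) (U : {set S}) (n m : nat).
Hypothesis p_ge0 : forall x y, 0 <= p x y.
Hypothesis p_sum1 : forall x, \sum_y p x y = 1.

Lemma first_timeS (A : pred (seq S)) t x (w : seq S) :
  (forall k s, A (take k s) -> A s) -> size w = t.+1 ->
  first_time A t.+1 (x :: w) = A (x :: w) && ~~ A (x :: take t w).
Proof.
move=> A_take sw; rewrite /first_time /= take_oversize ?sw //; congr (_ && _).
apply/forallP/idP => [/(_ ord_max)//|Aw s].
apply: contra Aw => As; apply: (A_take s.+1).
by rewrite /= -take_min; move: As; rewrite (minn_idPl _) // -ltnS.
Qed.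

Lemma prob_first_timeE (A : pred (seq S)) t x :
  prob_first_time p A x t = Ex p t x (fun w => (first_time A t (x :: w))%:R).
Proof. exact: (Ex_path_prob p t x (fun w => first_time A t (x :: w))). Qed.

Lemma prob_first_timeS (A : pred (seq S)) t x :
  (forall k s, A (take k s) -> A s) ->
  prob_first_time p A x t.+1 =
  Ex p t.+1 x (fun w => (A (x :: w))%:R) - Ex p t x (fun w => (A (x :: w))%:R).
Proof.
move=> A_take; rewrite prob_first_timeE.
rewrite -(Ex_take p_sum1 t 1) addn1 -ExB; apply: eq_Ex => w sw.
rewrite first_timeS //; case: (boolP (A (x :: take t w))) => [At|_].
  by rewrite andbF (A_take t.+1 (x :: w)) ?subrr.
by rewrite andbT subr0.
Qed.

Lemma prob_first_time0 (A : pred (seq S)) x :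
  prob_first_time p A x 0 = Ex p 0 x (fun w => (A (x :: w))%:R).
Proof.
rewrite prob_first_timeE /first_time /=.
by rewrite (_ : [forall s, _]) ?andbT //; apply/forallP => -[].
Qed.

Lemma cover_take U k (s : seq S) : U \subset take k s -> U \subset s.
Proof.
move=> /fintype.subsetP sU; apply/fintype.subsetP => y /sU; exact: mem_take.
Qed.

Hypothesis hs_bounded : forall x U, exists B, forall n, hs p n x U <= B.

(** The finite second moment gives P(tau > n) = O(1/n^2), so the boundary term n P(tau > n) of a
    summation by parts vanishes. *)
Lemma tl_le_div x U : exists2 B, 0 <= B &
  forall n, n.+1%:R * tl p n.+1 x U <= B / n.+1%:R.
Proof.
have [T hT] : exists T, forall x y, ht p x [set y] <= T.
  exists (\big[Num.max/0]_(xy : S * S) ht p xy.1 [set xy.2]) => y z.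
  exact: (le_bigmax 0 (fun xy : S * S => ht p xy.1 [set xy.2]) (y, z)).
set B := 2 * ht p x U * hmax p U - hmax p U ^+ 2 + 2 * T * hmax p U.
have hB n : tl p n x U * n%:R ^+ 2 <= B.
  have := dev_tl p_ge0 p_sum1 n x U 0; rewrite subr0 => /le_trans; apply.
  rewrite /dev expr0n mulr0 mul0r add0r subr0.
  exact: ws_le.
exists B => [|n]; first by apply: le_trans (hB 0%N); rewrite expr0n mulr0.
by rewrite ler_pdivlMr // mulrC mulrA -expr2 mulrC hB.
Qed.

(** Summation by parts turns the series of t P(tau = t) into the sum of the tails minus n P(tau >
    n). Since tau is almost surely finite, the infinite value has coefficient 0. *)
Lemma expected_first_timeE (A : pred (seq S)) x U :
  (forall w, A w = (U \subset w)) -> expected_first_time p A x = (ht p x U)%:E.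
Proof.
move=> AU; have A_take k s : A (take k s) -> A s.
  by rewrite !AU; exact: cover_take.
have P_cv n : Ex p n x (fun w => (A (x :: w))%:R) = cv p n x U.
  by apply: eq_Ex => w _; rewrite AU.
have S1 n : \sum_(0 <= t < n.+1) t%:R * prob_first_time p A x t =
            hs p n x U - n%:R * tl p n x U.
  elim: n => [|n IH]; first by rewrite big_nat1 !mul0r hs0 subrr.
  rewrite big_nat_recr //= IH prob_first_timeS // !P_cv hsS // /tl -natr1.
  by ring.
have S2 n : \sum_(0 <= t < n.+1) prob_first_time p A x t = cv p n x U.
  elim: n => [|n IH]; first by rewrite big_nat1 prob_first_time0 P_cv.
  by rewrite big_nat_recr //= IH prob_first_timeS // !P_cv addrCA subrr addr0.
have [B B0 hB] := tl_le_div x U.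
have harm0 : ((fun n : nat => B / n.+1%:R) @ \oo --> 0)%classic.
  by rewrite -[0 in X in (_ --> X)%classic](mulr0 B); apply: cvgMl_tmp; exact: cvg_harmonic.
have lim1 : ((fun n => n.+1%:R * tl p n.+1 x U) @ \oo --> 0)%classic.
  apply: (squeeze_cvgr _ (cvg_cst 0) harm0); apply: nearW => n.
  by rewrite hB mulr_ge0 ?tl_ge0.
have lim2 : ((fun n => tl p n.+1 x U) @ \oo --> 0)%classic.
  apply: (squeeze_cvgr _ (cvg_cst 0) lim1); apply: nearW => n.
  by rewrite tl_ge0 //= ler_peMl ?tl_ge0 // ler1n.
rewrite /expected_first_time.
have -> : limn (fun n => (\sum_(0 <= t < n) (t%:R * prob_first_time p A x t)%:E)%E) =
          (ht p x U)%:E.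
  under eq_fun do rewrite sumEFin.
  apply: cvg_lim => //; apply: cvg_EFin; first exact: nearW.
  (* After a shift by 2 the partial sums end at n + 1, where [S1] and [lim1] apply. *)
  rewrite -(cvg_shiftn 2) /=.
  rewrite (_ : (fun n => _) = fun n => hs p n.+1 x U - n.+1%:R * tl p n.+1 x U); last first.
    by apply/funext => n; rewrite addn2 S1.
  rewrite -[ht p x U]subr0; apply: cvgB => //.
  by rewrite (cvg_shiftS (fun n => hs p n x U)); exact: cvg_hs.
have -> : limn (fun n => (\sum_(0 <= t < n) (prob_first_time p A x t)%:E)%E) = 1%:E.
  under eq_fun do rewrite sumEFin.
  apply: cvg_lim => //; apply: cvg_EFin; first exact: nearW.
  rewrite -(cvg_shiftn 2) /=.
  rewrite (_ : (fun n => _) = fun n => 1 - tl p n.+1 x U); last first.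
    by apply/funext => n; rewrite addn2 S2 /tl opprB addrCA subrr addr0.
  by have := cvgB (cvg_cst (1 : R)) lim2; rewrite subr0; exact.
by rewrite subee // mule0 adde0.
Qed.

Lemma expected_hitting_timeE x y : expected_hitting_time p x y = (ht p x [set y])%:E.
Proof.
apply: expected_first_timeE => w; apply/idP/fintype.subsetP => [yw z|].
  by rewrite finset.in_set1 => /eqP->.
by apply; rewrite finset.in_set1.
Qed.

Lemma expected_cover_timeE x : expected_cover_time p x = (ht p x finset.setT)%:E.
Proof.
apply: expected_first_timeE => w; apply/forallP/fintype.subsetP => [wT y _|wT y].
  exact: wT.
by apply: wT; rewrite inE.
Qed.

Definition thit : R := \big[Num.max/0]_(xy : S * S) ht p xy.1 [set xy.2].

Lemma max_hitting_timeE : max_hitting_time p = thit%:E.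
Proof.
rewrite /max_hitting_time /thit -EFin_bigmax.
by apply: eq_bigr => xy _; rewrite expected_hitting_timeE.
Qed.

Lemma ht_thit x y : ht p x [set y] <= thit.
Proof. exact: (le_bigmax 0 (fun xy : S * S => ht p xy.1 [set xy.2]) (x, y)). Qed.

End FirstTime.

(** * Irreducible chains have bounded expected visiting times *)

Section Irreducible.
Variables (R : realType) (S : finType) (p : S -> S -> R).
Hypothesis p_ge0 : forall x y, 0 <= p x y.
Hypothesis p_sum1 : forall x, \sum_y p x y = 1.
Hypothesis irr : forall x y, exists n, 0 < step_prob p n x y.

(** Unlike [step_prob], [cv] is monotone in time, so the maximum of the finitely many connecting
    times serves all pairs at once. *)
Lemma irr_cv : exists n c, 0 < c /\ forall x y, c <= cv p n x [set y].
Proof.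
have [f hf] := choice (fun xy : S * S => irr xy.1 xy.2).
exists (\max_xy f xy)%N, (\big[Num.min/1]_(xy : S * S) cv p (\max_xy f xy)%N xy.1 [set xy.2]).
split=> [|x y]; last first.
  exact: (bigmin_le 1 (x, y) (fun xy : S * S => cv p (\max_xy f xy)%N xy.1 [set xy.2])).
apply: lt_bigmin => // -[x y] _ /=.
apply: (lt_le_trans (hf (x, y))); apply: (@le_trans _ _ (cv p (f (x, y)) x [set y])).
  rewrite step_probE cv1E; apply: ler_Ex => // w _; apply: ler_nat_bool => /eqP /= <-.
  exact: mem_last.
by apply: cv_homo => //; exact: leq_bigmax.
Qed.

Lemma irr_hs_bounded x (U : {set S}) : exists B, forall n, hs p n x U <= B.
Proof.
have [n [c [c0 nc]]] := irr_cv.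
exists ((#|U| * n)%N%:R / c ^+ #|U|) => m; apply: hs_bound => // [|z].
  exact: exprn_gt0.
by apply: cv_iter => //; exact: ltW.
Qed.

End Irreducible.

(** * Mixing of the base walk *)

Section Green.
Variables (R : realType) (S : finType) (p : S -> S -> R).
Implicit Types (x y z : S) (n m : nat).
Hypothesis p_ge0 : forall x y, 0 <= p x y.
Hypothesis p_sum1 : forall x, \sum_y p x y = 1.
Hypothesis p_sym : forall x y, p x y = p y x.

Let green n z x : R := \sum_(0 <= s < n) step_prob p s z x.

Let greenS n z x : green n.+1 z x = (z == x)%:R + \sum_y p z y * green n y x.
Proof.
rewrite /green big_nat_recl //; congr (_ + _).
by rewrite exchange_big /=; apply: eq_bigr => y _; rewrite mulr_sumr.
Qed.

(** Strong Markov property at the first visit to x: if it occurs within m steps, the n times counted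
    from it lie below n + m. *)
Let green_markov n m z x : cv p m z [set x] * green n x x <= green (n + m) z x.
Proof.
have g0 : 0 <= green n x x by apply: sumr_ge0 => s _; exact: step_prob_ge0.
have gx k : cv p k x [set x] * green n x x <= green (n + k) x x.
  rewrite cv_refl // mul1r /green [leRHS](@big_cat_nat _ _ _ n) ?leq_addr //=.
  by rewrite lerDl; apply: sumr_ge0 => s _; exact: step_prob_ge0.
elim: m z => [|m IH] z; have [->|zx] := eqVneq z x; try exact: gx.
  rewrite cv0 (_ : _ == _ = false) ?mul0r; first by apply: sumr_ge0 => s _; exact: step_prob_ge0.
  by apply/eqP => /setP/(_ x); rewrite !inE eqxx eq_sym zx.
rewrite cvS addnS greenS (negbTE zx) add0r mulr_suml; apply: ler_sum => y _.
rewrite -mulrA ler_wpM2l // (_ : _ :\ _ = [set x]) //.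
by apply/setP => u; rewrite !inE; case: eqP => // ->; rewrite (negbTE zx).
Qed.

Let pair n x : R := step_prob p n.*2 x x + step_prob p n.*2.+1 x x.

(* The difference is <u, (I - P) u> for u = (I + P) P^n delta_x. *)
Let pair_decr n x : pair n.+1 x <= pair n x.
Proof.
pose u y := step_prob p n y x + step_prob p n.+1 y x.
have dot (a b : nat) :
    step_prob p (a + b) x x = \sum_y step_prob p a y x * step_prob p b y x.
  by rewrite step_probD; apply: eq_bigr => y _; rewrite (step_prob_sym p_sym a).
have dotS a b : step_prob p (a + b).+1 x x =
    \sum_y \sum_z p y z * (step_prob p a y x * step_prob p b z x).
  rewrite -addnS dot; apply: eq_bigr => y _ /=.
  by rewrite mulr_sumr; apply: eq_bigr => z _; ring.
have uu : \sum_y \sum_z p y z * (u y * u y) =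
   step_prob p n.*2 x x + 2 * step_prob p n.*2.+1 x x + step_prob p n.*2.+2 x x.
  under eq_bigr do rewrite -mulr_suml p_sum1 mul1r.
  rewrite (_ : n.*2.+2 = n.+1 + n.+1)%N; last lia.
  rewrite (_ : n.*2.+1 = n + n.+1)%N; last lia.
  rewrite -addnn mulr_natl mulr2n !dot -!big_split /=.
  by apply: eq_bigr => y _; rewrite /u /=; ring.
have uz : \sum_y \sum_z p y z * (u z * u z) = \sum_y \sum_z p y z * (u y * u y).
  rewrite exchange_big /=; apply: eq_bigr => y _; apply: eq_bigr => z _.
  by rewrite p_sym.
have uPu : \sum_y \sum_z p y z * (u y * u z) =
   step_prob p n.*2.+1 x x + 2 * step_prob p n.*2.+2 x x + step_prob p n.*2.+3 x x.
  have -> : 2 * step_prob p n.*2.+2 x x =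
      step_prob p (n + n.+1).+1 x x + step_prob p (n.+1 + n).+1 x x.
    by rewrite addnS addSn addnn mulr_natl mulr2n.
  rewrite (_ : n.*2.+3 = (n.+1 + n.+1).+1)%N; last lia.
  rewrite -addnn !dotS -!big_split /=; apply: eq_bigr => y _.
  by rewrite -!big_split /=; apply: eq_bigr => z _; rewrite /u /=; ring.
have : 0 <= \sum_y \sum_z p y z * (u y - u z) ^+ 2.
  by apply: sumr_ge0 => y _; apply: sumr_ge0 => z _; rewrite mulr_ge0 ?sqr_ge0.
have -> : \sum_y \sum_z p y z * (u y - u z) ^+ 2 =
    \sum_y \sum_z p y z * (u y * u y) + \sum_y \sum_z p y z * (u z * u z)
    - 2 * \sum_y \sum_z p y z * (u y * u z).
  rewrite mulr_sumr -big_split -sumrB; apply: eq_bigr => y _ /=.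
  rewrite mulr_sumr -big_split -sumrB; apply: eq_bigr => z _ /=; ring.
rewrite uz uu uPu /pair doubleS; lra.
Qed.

(** The columns of a symmetric kernel sum to 1, so [green (T.*2 + m) z x] summed over z is 2T + m.
    Each term is at least a times [green T.*2 x x], which is at least T [pair T x] because [pair]
    decreases. *)
Lemma return_bound (a : R) m T x : 0 <= a -> (forall z, a <= cv p m z [set x]) ->
  a * #|S|%:R * (T%:R * pair T x) <= (T.*2 + m)%N%:R.
Proof.
move=> a0 am.
have pairT : T%:R * pair T x <= green T.*2 x x.
  suff : forall j, (j <= T)%N -> j%:R * pair T x <= green j.*2 x x by apply.
  elim=> [_|j IH jT]; first by rewrite mul0r /green big_geq.
  rewrite -natr1 mulrDl mul1r doubleS /green !big_nat_recr //= -addrA.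
  apply: lerD; first exact: IH (ltnW jT).
  rewrite -/(pair j x); have := ltnW jT => /subnKC <-.
  elim: (T - j)%N => [|i IHi]; first by rewrite addn0.
  by apply: le_trans IHi; rewrite addnS pair_decr.
have col s : \sum_z step_prob p s z x = 1.
  by rewrite -(step_prob_sum1 p_sum1 s x); apply: eq_bigr => z _; exact: step_prob_sym.
have g0 : 0 <= green T.*2 x x by apply: sumr_ge0 => s _; exact: step_prob_ge0.
have -> : (T.*2 + m)%N%:R = \sum_z green (T.*2 + m) z x.
  rewrite exchange_big /=; under eq_bigr do rewrite col.
  by rewrite big_const_nat subn0 iter_addr_0.
apply: (@le_trans _ _ (\sum_(z : S) a * green T.*2 x x)).
  rewrite sumr_const -[leRHS]mulr_natl [a * _]mulrC -mulrA. apply: ler_wpM2l => //.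
  exact: ler_wpM2l.
apply: ler_sum => z _; apply: le_trans (green_markov _ _ _ _).
by rewrite ler_wpM2r.
Qed.

End Green.

(** * Hitting times on the bipartite double cover *)

Section DoubleCover.
Variables (R : realType) (S : finType) (p : S -> S -> R).
Implicit Types (x y z : S) (a b c : bool) (u v : S * bool) (n m : nat).
Hypothesis p_ge0 : forall x y, 0 <= p x y.
Hypothesis p_sum1 : forall x, \sum_y p x y = 1.

(* The walk on the bipartite double cover, which records the parity of time. *)
Definition dbl u v : R := if v.2 == ~~ u.2 then p u.1 v.1 else 0.

Lemma sum_pair_bool (F : S * bool -> R) :
  \sum_v F v = \sum_y (F (y, true) + F (y, false)).
Proof.
transitivity (\sum_y \sum_b F (y, b)).
  by rewrite pair_big /=; apply: eq_bigr => -[].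
by apply: eq_bigr => y _; rewrite big_bool.
Qed.

Lemma dbl_sum (x : S) (a : bool) (g : S * bool -> R) :
  \sum_v dbl (x, a) v * g v = \sum_y p x y * g (y, ~~ a).
Proof.
rewrite sum_pair_bool; apply: eq_bigr => y _.
by case: a; rewrite /dbl /= mul0r ?addr0 ?add0r.
Qed.

Lemma dbl_ge0 u v : 0 <= dbl u v.
Proof. by rewrite /dbl; case: ifP. Qed.

Lemma dbl_sum1 u : \sum_v dbl u v = 1.
Proof.
case: u => x a; rewrite -[RHS](p_sum1 x).
under eq_bigr do rewrite -[dbl _ _]mulr1.
by rewrite (dbl_sum x a (fun=> 1)); apply: eq_bigr => y _; rewrite mulr1.
Qed.

Lemma dbl_sym : (forall x y, p x y = p y x) -> forall u v, dbl u v = dbl v u.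
Proof. by move=> p_sym [x []] [y []]; rewrite /dbl /= 1?p_sym. Qed.

Lemma step_prob_dbl n x a y b :
  step_prob dbl n (x, a) (y, b) = if b == a (+) odd n then step_prob p n x y else 0.
Proof.
elim: n x a => [|n IH] x a /=.
  by rewrite xpair_eqE addbF [b == a]eq_sym; case: (a == b); rewrite ?andbT ?andbF.
rewrite (dbl_sum x a (fun v => step_prob dbl n v (y, b))).
transitivity (\sum_z p x z * (if b == ~~ a (+) odd n then step_prob p n z y else 0)).
  by apply: eq_bigr => z _; rewrite IH.
rewrite addNb -addbN; case: ifP => // _.
by rewrite big1 // => z _; rewrite mulr0.
Qed.

Lemma Ex_dbl n x a (F : seq S -> R) :
  Ex dbl n (x, a) (fun w => F (map fst w)) = Ex p n x F.
Proof.
elim: n x a F => [|n IH] x a F //=.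
by rewrite dbl_sum; apply: eq_bigr => y _; rewrite (IH _ _ (fun w => F (y :: w))).
Qed.

Hypothesis p_sym : forall x y, p x y = p y x.
Hypothesis p_trans : forall x y, exists s : {perm S},
  (forall x y, p (s x) (s y) = p x y) /\ s x = y.
Hypothesis p_min : forall x y, 0 < p x y -> #|S|%:R^-1 <= p x y.
Hypothesis p_aper : aperiodic p.

Lemma flip_bij : bijective (fun u : S * bool => (u.1, ~~ u.2)).
Proof. by exists (fun u : S * bool => (u.1, ~~ u.2)) => -[x a] /=; rewrite negbK. Qed.

Lemma lift_bij (s : {perm S}) : bijective (fun u : S * bool => (s u.1, u.2)).
Proof.
by exists (fun u : S * bool => ((s^-1)%g u.1, u.2)) => -[x a] /=; rewrite ?permK ?permKV.
Qed.

Lemma cv_flip n x a y b :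
  cv dbl n (x, ~~ a) [set (y, ~~ b)] = cv dbl n (x, a) [set (y, b)].
Proof.
apply: (@cv_aut1 _ _ dbl _ flip_bij _ n (x, a) (y, b)) => -[? a'] [? b']; rewrite /dbl /=.
by rewrite (inj_eq negb_inj).
Qed.

Lemma cv_lift (s : {perm S}) (s_p : forall x y, p (s x) (s y) = p x y) n x a y b :
  cv dbl n (s x, a) [set (s y, b)] = cv dbl n (x, a) [set (y, b)].
Proof.
apply: (@cv_aut1 _ _ dbl _ (lift_bij s) _ n (x, a) (y, b)) => -[x' a'] [y' b']; rewrite /dbl /=.
by rewrite s_p.
Qed.

(** * Contradiction from assuming that odd returns are unlikely *)

Section Parity.
Variables (m L n : nat).
Hypothesis m_hit : forall x y, 9 / 10 <= cv p m x [set y].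
Hypothesis L_odd : odd L.
Hypothesis L_large : (#|S| <= L)%N.
Hypothesis n_large : (3 * m + L <= n)%N.
Hypothesis no_odd : forall x, cv dbl n (x, false) [set (x, true)] < 1 / 20.

(** Probability of meeting y within m steps at some time of parity b. *)
Let q x y b := cv dbl m (x, false) [set (y, b)].

Let qE x a y b : cv dbl m (x, a) [set (y, b)] = q x y (a (+) b).
Proof. by case: a => //; rewrite /q -(cv_flip m x false) addTb /= -{1}[b]negbK. Qed.

Let q_ge0 x y b : 0 <= q x y b.
Proof. exact: cv_ge0 dbl_ge0 _ _ _. Qed.

Let q_sum x y : 9 / 10 <= q x y false + q x y true.
Proof.
apply: le_trans (m_hit x y) _; rewrite cv1E -(Ex_dbl m x false) /q !cv1E -ExD.
apply: ler_Ex => [u v|w _]; first exact: dbl_ge0.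
rewrite -[x :: _]/(map fst ((x, false) :: w)).
case: mapP => [|_]; last by rewrite addr_ge0 ?ler0n.
by case=> -[y' []] yw /= ->; rewrite yw ?lerDl ?lerDr ?ler0n.
Qed.

(** A trip out and back of odd total parity is a return to x at an odd time within n steps, which
    [no_odd] makes unlikely. [loop3] treats three trips. *)
Let loop2 x y a : q x y a * q y x (~~ a) < 1 / 20.
Proof.
apply: le_lt_trans (no_odd x).
have -> : q y x (~~ a) = cv dbl m (y, a) [set (x, true)] by rewrite qE addbT.
apply: le_trans (cv_markov1 dbl_ge0 dbl_sum1 m m _ (y, a) _) _.
apply: cv_homo; [exact: dbl_ge0|exact: dbl_sum1|lia].
Qed.

Let loop3 x y z a b c : a (+) b (+) c -> q x y a * q y z b * q z x c < 1 / 20.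
Proof.
move=> abc; apply: le_lt_trans (no_odd x).
have -> : q z x c = cv dbl m (z, a (+) b) [set (x, true)].
  by rewrite qE; congr q; move: abc; case: a; case: b; case: c.
have -> : q y z b = cv dbl m (y, a) [set (z, a (+) b)].
  by rewrite qE addbA addbb addFb.
have h1 := cv_markov1 dbl_ge0 dbl_sum1 m m (x, false) (y, a) [set (z, a (+) b)].
apply: (@le_trans _ _ (cv dbl (m + m + m) (x, false) [set (x, true)])).
  apply: le_trans (cv_markov1 dbl_ge0 dbl_sum1 (m + m) m _ (z, a (+) b) _).
  by rewrite ler_wpM2r // cv_ge0 //; exact: dbl_ge0.
apply: cv_homo; [exact: dbl_ge0|exact: dbl_sum1|lia].
Qed.

(** The dominant parity of a trip from x to y, with true for odd. *)
Let k x y := q x y false <= 1 / 2.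

(** One parity of the trip out has weight at least 4/10; [loop2] then forces the parity of the trip
    back, and a second use of it that of the trip out. *)
Let kP x y : 7 / 10 < q x y (k x y).
Proof.
have := loop2 x y true; have := loop2 x y false.
have := q_sum x y; have := q_sum y x.
have := q_ge0 x y true; have := q_ge0 x y false.
have := q_ge0 y x true; have := q_ge0 y x false.
rewrite /k /=; case: (lerP (q x y false) (1 / 2)) => he;
move: (q x y false) (q x y true) (q y x false) (q y x true) he
  => e o e' o' he e'0 o'0 e0 o0 s' s1 l1 l2.
  have h1 : 0 <= (o - 4 / 10) * e' by rewrite mulr_ge0 //; lra.
  have h2 : 0 <= e * (o' - 3 / 4) by rewrite mulr_ge0 //; lra.
  lra.
have h1 : 0 <= (e - 1 / 2) * o' by rewrite mulr_ge0 //; lra.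
have h2 : 0 <= o * (e' - 3 / 4) by rewrite mulr_ge0 //; lra.
lra.
Qed.

(** Three dominant trips have probability above (7/10)^3, too much for a loop of odd parity. *)
Let k_cocycle x y z : k x y (+) k y z (+) k z x = false.
Proof.
apply/negP => /loop3 loop; have := loop x y z.
have := kP x y; have := kP y z; have := kP z x.
move: (q x y _) (q y z _) (q z x _) => a b c hc hb ha.
have : 7 / 10 * (7 / 10) < a * b by nra.
nra.
Qed.

Let kxx x : k x x = false.
Proof. by have := k_cocycle x x x; case: (k x x). Qed.

Let k_sym x y : k x y = k y x.
Proof. by have := k_cocycle x y x; rewrite kxx addbF; case: (k x y); case: (k y x). Qed.

Let k_trans x y z : k x z = k x y (+) k y z.
Proof.
have := k_cocycle x y z; rewrite (k_sym z x).
by case: (k x y); case: (k y z); case: (k x z).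
Qed.

(** Probability that one step violates the parity, that is, ends at a vertex whose label relative to
    x is even. *)
Let kappa x := \sum_z p x z * (~~ k x z)%:R.

Let kappa_const x y : kappa x = kappa y.
Proof.
have [s [s_p <-]] := p_trans x y.
rewrite /kappa [RHS](reindex s) /=; last by exists (s^-1)%g => u _; rewrite ?permK ?permKV.
by apply: eq_bigr => z _; rewrite s_p /k /q cv_lift.
Qed.

Let sgn t x z : R := (-1) ^+ (k x z (+) odd t).

(** By the cocycle relation the sign is a product over the steps, and each factor has mean 1 - 2
    kappa whatever the current vertex. *)
Let sgn_sum t x : \sum_z step_prob p t x z * sgn t x z = (1 - 2 * kappa x) ^+ t.
Proof.
elim: t x => [|t IH] x.
  rewrite expr0 (bigD1 x) //= eqxx mul1r big1 ?addr0 ?/sgn ?kxx //.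
  by move=> z; rewrite eq_sym => /negbTE ->; rewrite mul0r.
transitivity (\sum_y p x y * (-1) ^+ (~~ k x y) * \sum_z step_prob p t y z * sgn t y z).
  under [LHS]eq_bigr do rewrite /= mulr_suml.
  rewrite exchange_big /=; apply: eq_bigr => y _.
  rewrite mulr_sumr; apply: eq_bigr => z _.
  rewrite /sgn (k_trans x y z) /=.
  rewrite (_ : _ (+) ~~ _ = ~~ k x y (+) (k y z (+) odd t)); last first.
    by case: (k x y); case: (k y z); case: (odd t).
  by rewrite signr_addb; ring.
under eq_bigr do rewrite IH (kappa_const _ x).
rewrite -mulr_suml exprS; congr (_ * _).
rewrite -[X in X - _](p_sum1 x) /kappa mulr_sumr -sumrB; apply: eq_bigr => y _.
by case: (k x y); rewrite /= ?expr1 ?expr0; ring.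
Qed.

(** Without violating steps, [k y z] would be the parity of every travel time from y to z and all
    return times would be even, against aperiodicity. One violating edge already contributes
    1/|S|. *)
Let kappa_ge x : #|S|%:R^-1 <= kappa x.
Proof.
have kappa_term z : 0 <= p x z * (~~ k x z)%:R by rewrite mulr_ge0.
case: (pselect (exists z, 0 < p x z /\ ~~ k x z)) => [[z [xz kz]]|none].
  apply: le_trans (p_min xz) _; rewrite /kappa (bigD1 z) //= kz mulr1 lerDl.
  by apply: sumr_ge0 => z' _; rewrite mulr_ge0.
have kappa0 y : kappa y = 0.
  rewrite (kappa_const y x) /kappa big1 // => z _.
  have [kz|kz] := boolP (k x z); first by rewrite mulr0.
  apply/eqP; rewrite mulr1 eq_le p_ge0 andbT leNgt; apply/negP => xz.
  by apply: none; exists z.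
have k1 y z : 0 < p y z -> k y z.
  move=> yz; apply/negPn/negP => kz; have := kappa0 y.
  have : 0 < kappa y.
    rewrite /kappa (bigD1 z) //= kz mulr1 ltr_wpDr //.
    by apply: sumr_ge0 => z' _; rewrite mulr_ge0.
  by move=> + h; rewrite h ltxx.
have kt t y z : 0 < step_prob p t y z -> k y z = odd t.
  elim: t y => [|t IH] y /=.
    by case: (eqVneq y z) => [-> _|]; rewrite ?kxx ?ltxx.
  move=> pos; have [y' hy'] : exists y', 0 < p y y' * step_prob p t y' z.
    apply/not_existsP => none'; suff : \sum_z0 p y z0 * step_prob p t z0 z <= 0.
      by rewrite leNgt pos.
    by apply: sumr_le0 => y' _; rewrite leNgt; apply/negP; exact: none'.
  have yy' : 0 < p y y'.
    by rewrite lt_def p_ge0 andbT; apply/eqP => h; rewrite h mul0r ltxx in hy'.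
  have y'z : 0 < step_prob p t y' z by rewrite -(pmulr_rgt0 _ yy').
  by rewrite (k_trans y y' z) (k1 _ _ yy') (IH _ y'z).
have /eqP : 2 = 1%N.
  apply: (p_aper (x := x)) => t _ /kt; rewrite kxx dvdn2 => <-//.
by [].
Qed.

(** With N = |S|, the base times 1 + 2/N is at most 1, and (1 + 2/N)^L >= 3 by Bernoulli's
    inequality since L >= N. For a nonpositive base the odd exponent suffices. *)
Let sgn_small x : (1 - 2 * kappa x) ^+ L <= 1 / 3.
Proof.
have S0 : (0 < #|S|)%N by apply/card_gt0P; exists x.
have S0' : 0 < #|S|%:R :> R by rewrite ltr0n.
have [k1|k1] := lerP (1 - 2 * kappa x) 0.
  apply: (@le_trans _ _ 0); last by lra.
  by rewrite exprn_odd_le0.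
set a := 2 / #|S|%:R : R.
have a0 : 0 <= a by rewrite divr_ge0.
have ra : (1 - 2 * kappa x) * (1 + a) <= 1.
  have : 1 - 2 * kappa x <= 1 - a by have := kappa_ge x; rewrite /a; lra.
  nra.
have : (1 - 2 * kappa x) ^+ L * (1 + a) ^+ L <= 1.
  by rewrite -exprMn exprn_ile1 //; apply: mulr_ge0; [exact: ltW|exact: addr_ge0].
have : 3 <= (1 + a) ^+ L.
  apply: le_trans (bernoulli L a0).
  have : 2 <= a * L%:R; last lra.
  rewrite /a mulrAC ler_pdivlMr //. by rewrite ler_pM2l ?ler_nat.
have : 0 <= (1 - 2 * kappa x) ^+ L by rewrite exprn_ge0 // ltW.
nra.
Qed.

(** After L steps, an odd number, the walk is with probability at least 1/3 at a vertex of even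
    label. The trip back is then even with probability above 7/10, and 7/30 > 1/20 contradicts
    [no_odd]. *)
Lemma parity_contra (x : S) : False.
Proof.
have bad : 1 / 3 <= \sum_z step_prob p L x z * (~~ k x z)%:R.
  have : \sum_z step_prob p L x z * (~~ k x z)%:R =
      (1 - (1 - 2 * kappa x) ^+ L) / 2.
    rewrite -sgn_sum -[X in X - _](step_prob_sum1 p_sum1 L x) -sumrB mulr_suml.
    apply: eq_bigr => z _; rewrite /sgn L_odd addbT.
    by case: (k x z); rewrite /= ?expr1 ?expr0; field.
  by move=> ->; have := sgn_small x; lra.
have : \sum_z step_prob p L x z * ((~~ k x z)%:R * (7 / 10)) <=
       cv dbl (L + m) (x, false) [set (x, true)].
  apply: le_trans (cv_step_prob dbl_ge0 L m (x, false) [set (x, true)]).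
  rewrite sum_pair_bool; apply: ler_sum => z _; rewrite !step_prob_dbl L_odd /= mul0r addr0.
  rewrite ler_wpM2l ?step_prob_ge0 // qE addTb /=.
  case: (boolP (k x z)) => kz; rewrite ?mul0r ?q_ge0 //= mul1r.
  by have := kP z x; rewrite k_sym (negbTE kz) => /ltW.
have -> : \sum_z step_prob p L x z * ((~~ k x z)%:R * (7 / 10)) =
    (\sum_z step_prob p L x z * (~~ k x z)%:R) * (7 / 10).
  by rewrite mulr_suml; apply: eq_bigr => z _; ring.
move=> h1.
have h2 : cv dbl (L + m) (x, false) [set (x, true)] <= cv dbl n (x, false) [set (x, true)].
  apply: cv_homo; [exact: dbl_ge0|exact: dbl_sum1|lia].
have := no_odd x; lra.
Qed.

End Parity.

(** The fibre over y is met within m steps with probability 9/10; a wrong parity is corrected within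
    n more steps with probability 1/20. The product 9/200 exceeds 1/25. *)
Lemma dbl_hit m L n : (forall x y, 9 / 10 <= cv p m x [set y]) ->
  odd L -> (#|S| <= L)%N -> (3 * m + L <= n)%N ->
  forall u v, 1 / 25 <= cv dbl (m + n) u [set v].
Proof.
move=> m_hit L_odd L_large n_large u [y b].
have odd_y a : 1 / 20 <= cv dbl n (y, a) [set (y, ~~ a)].
  suff : 1 / 20 <= cv dbl n (y, false) [set (y, true)].
    by case: a => //; rewrite -(cv_flip n y true y false).
  rewrite leNgt; apply/negP => hy.
  apply: (@parity_contra m L n) => // x; have [s [s_p <-]] := p_trans y x.
  by rewrite cv_lift.
have hB (z : S * bool) : z.1 == y -> 1 / 20 <= cv dbl n z [set (y, b)].
  case: z => z c /= /eqP->; have [->|cb] := eqVneq c b.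
    by rewrite (cv_refl dbl_sum1); lra.
  by rewrite (_ : b = ~~ c) //; move: cb; case: (b); case: (c).
apply: le_trans (cv_markov dbl_ge0 dbl_sum1 (B := fun z : S * bool => z.1 == y) m u _ hB); last by lra.
case: u => x a; have := m_hit x y; rewrite cv1E -(Ex_dbl m x a) => hx.
suff : Ex dbl m (x, a) (fun w => (y \in x :: map fst w)%:R) <=
  Ex dbl m (x, a) (fun w => (has (fun z : S * bool => z.1 == y) ((x, a) :: w))%:R) by lra.
apply: ler_Ex => [? ?|w _]; first exact: dbl_ge0.
apply: ler_nat_bool; rewrite -[x :: _]/(map fst ((x, a) :: w)) => /mapP[z zw yz].
by apply/hasP; exists z => //; rewrite yz.
Qed.

End DoubleCover.

(** The properties of simple random walk on a transitive graph that the estimates use; their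
    constants are uniform over this class. *)
Record walk (R : realType) (S : finType) (p : S -> S -> R) : Prop := Walk {
  walk_ge0 : forall x y, 0 <= p x y;
  walk_sum1 : forall x, \sum_y p x y = 1;
  walk_sym : forall x y, p x y = p y x;
  walk_trans : forall x y, exists s : {perm S},
    (forall u v, p (s u) (s v) = p u v) /\ s x = y;
  walk_irr : forall x y, exists n, 0 < step_prob p n x y;
  walk_min : forall x y, 0 < p x y -> #|S|%:R^-1 <= p x y;
  walk_aper : aperiodic p;
  walk_card : (1 < #|S|)%N }.

(** * Hitting times, return probabilities and mixing of a transitive walk *)

Section WalkFacts.
Variables (R : realType) (S : finType) (p : S -> S -> R).
Hypothesis wp : walk p.
Let p_ge0 := walk_ge0 wp.
Let p_sum1 := walk_sum1 wp.

Lemma walk_bounded x (U : {set S}) : exists B, forall n, hs p n x U <= B.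
Proof. exact: irr_hs_bounded (walk_irr wp) x U. Qed.

(** At time k at most k + 1 vertices have been visited, so the truncated hitting times from x sum to
    at least N(N - 1)/2, while each is at most [thit]. *)
Lemma card_thit : #|S|%:R - 1 <= 2 * thit p.
Proof.
have [x _] : exists x : S, true by have := walk_card wp; case: (pickP {: S}) => [x|/eq_card0 ->] //; exists x.
set N := #|S|.
have N0 : 0 < N%:R :> R by rewrite ltr0n (ltn_trans _ (walk_card wp)).
have up : \sum_y hs p N x [set y] <= N%:R * thit p.
  rewrite mulr_natl -sumr_const; apply: ler_sum => y _.
  exact: le_trans (hs_le_ht p_ge0 p_sum1 walk_bounded _ _ _) (ht_thit p _ _).
have low : \sum_(0 <= k < N) (N%:R - k.+1%:R) <= \sum_y hs p N x [set y].
  rewrite exchange_big /=; apply: ler_sum => k _.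
  have -> : N%:R = \sum_(y : S) 1 :> R by rewrite sumr_const.
  rewrite /tl sumrB lerB // sum_cv_le //.
have gauss n : 2 * \sum_(0 <= k < n) (N%:R - k.+1%:R) = n%:R * (2 * N%:R - n%:R - 1) :> R.
  elim: n => [|n IH]; first by rewrite big_geq // mulr0 mul0r.
  by rewrite big_nat_recr //= mulrDr IH -natr1; ring.
have := gauss N; move: low up; move: (\sum_y _) (\sum_(0 <= k < N) _) => a b ba aN bE.
have : N%:R * (2 * N%:R - N%:R - 1) <= N%:R * (2 * thit p) by rewrite -bE; nra.
by rewrite ler_pM2l //; lra.
Qed.

Lemma thit_gt0 : 1 / 2 <= thit p.
Proof.
have := card_thit; have : 2 <= #|S|%:R :> R by rewrite ler_nat (walk_card wp).
lra.
Qed.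

Lemma cv_thit (c : R) m x y : 0 < c -> thit p <= c * m%:R -> 1 - c <= cv p m x [set y].
Proof.
move=> c0 hm; have := tl_markov p_ge0 p_sum1 walk_bounded m x [set y].
have := ht_thit p x y; rewrite /tl -natr1.
have := cv_ge0 p_ge0 m x [set y]; have m0 : 0 <= m%:R :> R by rewrite ler0n.
move: (ht _ _ _) (cv _ _ _ _) => h v v0 hT hv.
rewrite leNgt; apply/negP => vc.
have : 0 < (1 - c - v) * (m%:R + 1) by apply: mulr_gt0; lra.
nra.
Qed.

(** [return_bound] on the double cover, where returns at odd times are impossible; k rounds of m + n
    steps raise the hitting probability from 1/25 to 1 - eta. *)
Lemma walk_return (k t : nat) x (eta : R) : (24 / 25) ^+ k <= eta -> eta < 1 ->
  (1 - eta) * #|S|%:R * (t%:R * step_prob p t.*2 x x) <= t%:R + 29 * k%:R * thit p.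
Proof.
move=> k_eta eta1.
have T0 := thit_gt0; have NT := card_thit.
(* With m >= 10 [thit], Markov's inequality gives hitting probability 9/10. A round lasts 4m + 2N +
   1 <= 58 [thit] steps, by m <= 12 [thit], [card_thit] and [thit] >= 1/2. *)
pose m := (Num.trunc (10 * thit p)).+1; pose L := #|S|.*2.+1; pose n := (3 * m + L)%N.
have m_up : m%:R <= 12 * thit p.
  have : (Num.trunc (10 * thit p))%:R <= 10 * thit p by rewrite truncn_le // mulr_ge0 //; lra.
  by rewrite /m -natr1; lra.
have m_low : 10 * thit p <= m%:R by rewrite ltW // truncnS_gt.
have m_hit x' y' : 9 / 10 <= cv p m x' [set y'].
  have -> : 9 / 10 = 1 - 1 / 10 :> R by field.
  by apply: cv_thit; lra.
have hit u v : 1 - eta <= cv (dbl p) (k * (m + n)) u [set v].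
  have : tl (dbl p) (k * (m + n)) u [set v] <= eta.
    apply: le_trans k_eta; have -> : 24 / 25 = 1 - 1 / 25 :> R by field.
    apply: tl_geom => [u' v'||z]; [exact: dbl_ge0|exact: dbl_sum1|].
    apply: (@dbl_hit _ _ p p_ge0 p_sum1 (walk_trans wp) (walk_min wp) (walk_aper wp) m L n) => //.
      by rewrite /L /= odd_double.
    by rewrite /L -addnn; lia.
  by rewrite /tl; lra.
have eta0 : 0 <= 1 - eta by lra.
have := return_bound (dbl_ge0 p_ge0) (dbl_sum1 p_sum1) (dbl_sym (walk_sym wp)) t eta0
  (fun z => hit z (x, false)).
rewrite !step_prob_dbl /= !odd_double /= addr0 card_prod card_bool natrM.
have -> : (t.*2 + k * (m + n))%N%:R = 2 * t%:R + k%:R * (4 * m%:R + (2 * #|S|%:R + 1)) :> R.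
  rewrite /n /L natrD natrM -mul2n natrM; congr (_ + _ * _).
  by rewrite -[#|S|.*2.+1]addn1 -mul2n !(natrD, natrM); ring.
move=> h.
have : k%:R * (4 * m%:R + (2 * #|S|%:R + 1)) <= k%:R * (58 * thit p).
  by rewrite ler_wpM2l ?ler0n //; lra.
lra.
Qed.

(** By symmetry, the sum of the squares of p^t(x,y) is p^2t(x,x). *)
Lemma walk_l2 t x :
  \sum_y (step_prob p t x y - #|S|%:R^-1) ^+ 2 = step_prob p t.*2 x x - #|S|%:R^-1.
Proof.
have N0 : #|S|%:R != 0 :> R by rewrite pnatr_eq0 -lt0n (ltn_trans _ (walk_card wp)).
transitivity (\sum_y (step_prob p t x y * step_prob p t y x -
   (2 * #|S|%:R^-1 * step_prob p t x y - #|S|%:R^-1 ^+ 2))).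
  apply: eq_bigr => y _; rewrite (step_prob_sym (walk_sym wp) t y x); ring.
rewrite sumrB -step_probD addnn sumrB -mulr_sumr step_prob_sum1 // sumr_const.
rewrite -[in X in _ - (_ - X)]mulr_natl; congr (_ - _); field.
exact: N0.
Qed.

End WalkFacts.

(** With e = d^2, K makes the error 29 k [thit] of [walk_return] at most e t. Hence N p^2t(x,x) - 1
    = O(e), which bounds the L2 distance and then total variation. *)
Lemma walk_mixing (R : realType) (d : R) : 0 < d <= 1 ->
  exists2 K : R, 0 < K & forall (S : finType) (p : S -> S -> R), walk p ->
    forall t, K * thit p <= t%:R -> forall x,
    2^-1 * (\sum_y `|step_prob p t x y - #|S|%:R^-1|) <= d.
Proof.
move=> /andP[d0 d1]; set e := d ^+ 2.
have e0 : 0 < e by rewrite exprn_gt0.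
have e1 : e <= 1 by rewrite exprn_ile1 // ltW.
(* Then 1 - eta = 1/(1 + e), so N p^2t(x,x) <= (1 + e)^2. *)
pose eta := e / (1 + e).
have etaE : eta * (1 + e) = e by rewrite /eta; field; lra.
have eta0 : 0 < eta by rewrite divr_gt0 //; lra.
have eta1 : eta < 1 by nra.
have [k hk] : exists k, (24 / 25) ^+ k <= eta.
  pose k := (Num.trunc (24 / eta)).+1; exists k.
  have kb : 24 / eta <= k%:R by rewrite ltW // truncnS_gt.
  have k1 : 24 <= k%:R * eta by rewrite -ler_pdivrMr.
  have : 1 + 1 / 24 * k%:R <= (1 + 1 / 24) ^+ k :> R by apply: bernoulli; lra.
  have : (24 / 25) ^+ k * (1 + 1 / 24) ^+ k = 1 :> R.
    by rewrite -exprMn (_ : _ * _ = 1) ?expr1n //; field.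
  have : 0 <= (24 / 25) ^+ k :> R by rewrite exprn_ge0 //; lra.
  move: ((24 / 25) ^+ k) ((1 + 1 / 24) ^+ k) => u v u0 uv hv.
  have : u * (1 + 1 / 24 * k%:R) <= 1 by rewrite -[leRHS]uv; exact: ler_wpM2l.
  have : 1 <= eta * (1 + 1 / 24 * k%:R) by nra.
  move=> h1 h2; have k0 : 0 <= k%:R :> R by rewrite ler0n.
  have hk : 0 < 1 + 1 / 24 * k%:R :> R by lra.
  by rewrite -(ler_pM2r hk) (le_trans h2 h1).
exists (29 * k%:R / e + 1) => [|S p wp t ht x].
  by rewrite ltr_wpDl // divr_ge0 ?mulr_ge0 // ltW.
have T0 := thit_gt0 wp.
have N0 : 0 < #|S|%:R :> R by rewrite ltr0n (ltn_trans _ (walk_card wp)).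
have t0 : 0 < t%:R :> R.
  apply: lt_le_trans ht; apply: mulr_gt0; last lra.
  by rewrite ltr_wpDl // divr_ge0 ?mulr_ge0 // ltW.
have kt : 29 * k%:R * thit p <= e * t%:R.
  have : e * ((29 * k%:R / e + 1) * thit p) <= e * t%:R by rewrite ler_wpM2l // ltW.
  have -> : e * ((29 * k%:R / e + 1) * thit p) = 29 * k%:R * thit p + e * thit p.
    by field; lra.
  nra.
have := walk_return wp t x hk eta1.
set r := step_prob p t.*2 x x => hr.
have Nr : (1 - eta) * (#|S|%:R * r) <= 1 + e.
  rewrite -(ler_pM2l t0); nra.
have Nr3 : #|S|%:R * r - 1 <= 4 * e.
  have : (1 + e) * ((1 - eta) * (#|S|%:R * r)) <= (1 + e) * (1 + e).
    by rewrite ler_wpM2l //; lra.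
  have -> : (1 + e) * ((1 - eta) * (#|S|%:R * r)) =
    (1 + e - eta * (1 + e)) * (#|S|%:R * r) by ring.
  by rewrite etaE addrK mul1r; nra.
(* Weighted AM-GM in place of the Cauchy-Schwarz inequality; the weights make both sums at most
   d. *)
have amgm (a : R) : `|a| <= #|S|%:R / (4 * d) * a ^+ 2 + d / #|S|%:R.
  have : 0 <= (#|S|%:R * `|a| - 2 * d) ^+ 2 by rewrite sqr_ge0.
  have -> : a ^+ 2 = `|a| ^+ 2 by rewrite real_normK ?num_real.
  move=> h; rewrite -subr_ge0.
  have -> : #|S|%:R / (4 * d) * `|a| ^+ 2 + d / #|S|%:R - `|a| =
    (#|S|%:R * `|a| - 2 * d) ^+ 2 / (4 * d * #|S|%:R) by field; rewrite !gt_eqF.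
  by rewrite divr_ge0 // ?mulr_ge0 // ltW.
have : \sum_y `|step_prob p t x y - #|S|%:R^-1| <=
  \sum_y (#|S|%:R / (4 * d) * (step_prob p t x y - #|S|%:R^-1) ^+ 2 + d / #|S|%:R).
  by apply: ler_sum => y _; exact: amgm.
have sum_d : \sum_(y : S) d / #|S|%:R = d.
  by rewrite sumr_const -[LHS]mulr_natr divfK // gt_eqF.
rewrite big_split /= sum_d -mulr_sumr walk_l2 // -/r.
have -> : #|S|%:R / (4 * d) * (r - #|S|%:R^-1) = (#|S|%:R * r - 1) / (4 * d).
  by field; rewrite !gt_eqF.
have : (#|S|%:R * r - 1) / (4 * d) <= d.
  by rewrite ler_pdivrMr ?mulr_gt0 //; move: Nr3; rewrite /e; lra.
lra.
Qed.

(** * The lamplighter walk *)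

Section LampKernel.
Variables (R : realType) (V : finType).
Implicit Types (f g h : {ffun V -> bool}) (A B E : {set V}).

(* Refreshing the lamps of A by independent fair bits. *)
Definition lampk A f h : R := \prod_v (if v \in A then 2^-1 else (f v == h v)%:R).

Lemma sum_ffun_prod (a : V -> bool -> R) :
  \sum_(h : {ffun V -> bool}) \prod_v a v (h v) = \prod_v (a v true + a v false).
Proof. by rewrite -bigA_distr_bigA; apply: eq_bigr => v _; rewrite big_bool. Qed.

Lemma lampk_ge0 A f h : 0 <= lampk A f h.
Proof. by apply: prodr_ge0 => v _; case: ifP. Qed.

Lemma lampkE A f h : lampk A f h =
  if [forall z, (z \notin A) ==> (f z == h z)] then 2^-1 ^+ #|A| else 0.
Proof.
case: forallP => [fh|/forallP]; last first.
  rewrite negb_forall => /existsP[z]; rewrite negb_imply => /andP[/negbTE zA /negbTE fz].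
  by rewrite /lampk (bigD1 z) //= zA fz mul0r.
rewrite -prodr_const [RHS]big_mkcond /=; apply: eq_bigr => z _.
by have := fh z; case: (z \in A) => //= ->.
Qed.

Lemma lampk_set0 f h : lampk finset.set0 f h = (f == h)%:R.
Proof.
rewrite lampkE cards0 expr0; case: eqP => [->|fh].
  by rewrite (_ : [forall _, _]) //; apply/forallP => z; rewrite eqxx implybT.
rewrite ifN //; apply/negP => /forallP fz; apply: fh; apply/ffunP => z.
by have := fz z; rewrite inE => /eqP.
Qed.

Lemma lampk_setT f h : lampk finset.setT f h = 2^-1 ^+ #|V|.
Proof.
rewrite lampkE cardsT (_ : [forall _, _]) //.
by apply/forallP => z; rewrite inE.
Qed.

Lemma lampk_comp A B f h : \sum_g lampk A f g * lampk B g h = lampk (A :|: B) f h.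
Proof.
under eq_bigr do rewrite -big_split /=.
rewrite (sum_ffun_prod (fun v b => (if v \in A then 2^-1 else (f v == b)%:R) *
   (if v \in B then 2^-1 else (b == h v)%:R))).
apply: eq_bigr => v _; rewrite inE.
case: (v \in A); case: (v \in B) => /=; case: (f v); case: (h v) => /=; by field.
Qed.

Lemma lampk_sum1 A f : \sum_h lampk A f h = 1.
Proof.
rewrite (sum_ffun_prod (fun v b => if v \in A then 2^-1 else (f v == b)%:R)).
rewrite big1 // => v _; case: (v \in A); first by field.
by case: (f v); rewrite /= ?addr0 ?add0r.
Qed.

(** Moves along an edge and along a loop become one formula, since [[set a; b]] has two elements or
    one. *)
Lemma lamplighter_walkE (q : V -> V -> R) f a h b :
  lamplighter_walk q (f, a) (h, b) = q a b * lampk [set a; b] f h.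
Proof.
rewrite /lamplighter_walk lampkE; case: eqVneq => [<-|ab].
  rewrite finset.setUid cards1 expr1.
  rewrite (_ : [forall z, _] = [forall z, (z \notin [set a]) ==> (f z == h z)]).
    by case: ifP; rewrite ?mulr0.
  by apply: eq_forallb => z; rewrite inE.
rewrite cards2 ab; rewrite (_ : [forall z, _] =
  [forall z, (z \notin [set a; b]) ==> (f z == h z)]).
  by case: ifP; rewrite ?mulr0 // => _; field.
by apply: eq_forallb => z; rewrite !inE negb_or.
Qed.

(** * The sum of the lamp signs as a test statistic *)

Let sg (b : bool) : R := if b then -1 else 1.
Let f0 : {ffun V -> bool} := [ffun=> false].

(** Orthogonality of characters: a refreshed lamp has mean sign 0, an untouched lamp keeps sign
    1. *)
Let lampk_sg A E : \sum_h lampk A f0 h * (\prod_(v in E) sg (h v)) =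
  \prod_(v in E) (v \notin A)%:R.
Proof.
pose a v b := (if v \in A then 2^-1 else (f0 v == b)%:R) * (if v \in E then sg b else 1).
transitivity (\sum_(h : {ffun V -> bool}) \prod_v a v (h v)).
  by apply: eq_bigr => h _; rewrite big_split -big_mkcond.
rewrite sum_ffun_prod [RHS]big_mkcond /a.
apply: eq_bigr => v _; rewrite ffunE /sg.
by case: (v \in A); case: (v \in E) => /=; field.
Qed.

Let ss h : R := \sum_v sg (h v).
Let unl A : R := #|~: A|%:R.

Let unlE A : unl A = \sum_v (v \notin A)%:R.
Proof.
rewrite /unl -sum1_card natr_sum big_mkcond /=; apply: eq_bigr => v _.
by rewrite inE; case: (v \in A).
Qed.

Let mean_ss A : \sum_h lampk A f0 h * ss h = unl A.
Proof.
rewrite unlE; under eq_bigr do rewrite mulr_sumr.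
rewrite exchange_big /=; apply: eq_bigr => v _.
have -> : (v \notin A)%:R = \prod_(w in [set v]) (w \notin A)%:R :> R by rewrite big_set1.
rewrite -lampk_sg.
by apply: eq_bigr => h _; rewrite big_set1.
Qed.

(** Off the diagonal the products of signs have the product of the means; the diagonal adds at most
    |V|, which thus bounds the variance. *)
Let sqr_ss A : \sum_h lampk A f0 h * ss h ^+ 2 <= unl A ^+ 2 + #|V|%:R.
Proof.
have -> : unl A ^+ 2 + #|V|%:R =
    \sum_v \sum_w ((v \notin A)%:R * (w \notin A)%:R + (v == w)%:R).
  rewrite expr2 unlE mulr_suml -sum1_card natr_sum -big_split /=.
  apply: eq_bigr => v _; rewrite big_split mulr_sumr /=; congr (_ + _).
  by rewrite (bigD1 v) //= eqxx big1 ?addr0 // => w /negbTE; rewrite eq_sym => ->.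
have -> : \sum_h lampk A f0 h * ss h ^+ 2 =
    \sum_v \sum_w \sum_h lampk A f0 h * (sg (h v) * sg (h w)).
  transitivity (\sum_h \sum_v \sum_w lampk A f0 h * (sg (h v) * sg (h w))).
    apply: eq_bigr => h _; rewrite expr2 /ss mulr_suml mulr_sumr.
    by apply: eq_bigr => v _; rewrite !mulr_sumr.
  by rewrite exchange_big; apply: eq_bigr => v _; rewrite exchange_big.
apply: ler_sum => v _; apply: ler_sum => w _; have [<-|vw] := eqVneq v w.
  rewrite (eq_bigr (fun h => lampk A f0 h)) ?lampk_sum1 ?lerDr ?mulr_ge0 //.
  by move=> h _; rewrite /sg; case: (h v); rewrite ?mulrNN !mulr1.
have prod2 (F : V -> R) : \prod_(z in [set v; w]) F z = F v * F w.
  by rewrite big_setU1 ?inE //= big_set1.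
rewrite addr0 -(prod2 (fun z => (z \notin A)%:R)) -lampk_sg le_eqVlt.
by apply/orP; left; apply/eqP; apply: eq_bigr => h _; rewrite prod2.
Qed.

Let low (M : R) h : bool := 4 * ss h ^+ 2 <= M * #|V|%:R.

(** Chebyshev: under [low] the sum of signs is at most half its mean, a deviation whose square is at
    least M |V| / 4, against a variance of at most |V|. *)
Lemma lampk_low (M : R) A : 0 < M -> (0 < #|V|)%N -> M * #|V|%:R <= unl A ^+ 2 ->
  \sum_h lampk A f0 h * (low M h)%:R <= 4 / M.
Proof.
move=> M0 V0 MA; have V0' : 0 < #|V|%:R :> R by rewrite ltr0n.
have MV : 0 < M * #|V|%:R by rewrite mulr_gt0.
have u0 : 0 <= unl A by rewrite /unl.
apply: (@le_trans _ _ (\sum_h lampk A f0 h * (4 / (M * #|V|%:R) * (ss h - unl A) ^+ 2))).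
  apply: ler_sum => h _; rewrite ler_wpM2l ?lampk_ge0 //.
  case: (boolP (low M h)) => [|_]; last first.
    by rewrite mulr_ge0 ?sqr_ge0 // divr_ge0 // ltW.
  rewrite /low => sM; rewrite mulrAC ler_pdivlMr // mul1r.
  have : ss h <= unl A / 2 by rewrite leNgt; apply/negP => hs; nra.
  nra.
have -> : \sum_h lampk A f0 h * (4 / (M * #|V|%:R) * (ss h - unl A) ^+ 2) =
    4 / (M * #|V|%:R) * (\sum_h lampk A f0 h * ss h ^+ 2 -
      2 * unl A * \sum_h lampk A f0 h * ss h + unl A ^+ 2 * \sum_h lampk A f0 h).
  rewrite !mulr_sumr -sumrB -big_split mulr_sumr /=.
  by apply: eq_bigr => h _; ring.
rewrite mean_ss lampk_sum1 mulr1.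
have -> : 4 / M = 4 / (M * #|V|%:R) * #|V|%:R by field; rewrite !gt_eqF.
rewrite ler_wpM2l //; first by rewrite divr_ge0 // ltW.
by have := sqr_ss A; lra.
Qed.

(** Chebyshev again, now with mean 0. *)
Lemma unif_low (M : R) : 0 < M -> (0 < #|V|)%N ->
  1 - 4 / M <= \sum_h 2^-1 ^+ #|V| * (low M h)%:R.
Proof.
move=> M0 V0; have V0' : 0 < #|V|%:R :> R by rewrite ltr0n.
have MV : 0 < M * #|V|%:R by rewrite mulr_gt0.
have -> : \sum_h 2^-1 ^+ #|V| * (low M h)%:R =
    \sum_h lampk finset.setT f0 h * (low M h)%:R :> R.
  by apply: eq_bigr => h _; rewrite lampk_setT.
apply: (@le_trans _ _ (\sum_h lampk finset.setT f0 h *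
   (1 - 4 / (M * #|V|%:R) * ss h ^+ 2))); last first.
  apply: ler_sum => h _; rewrite ler_wpM2l ?lampk_ge0 //.
  case: (boolP (low M h)) => [_|].
    by rewrite gerBl mulr_ge0 ?sqr_ge0 // divr_ge0 // ltW.
  by rewrite /low -ltNge => /ltW hM; rewrite subr_le0 mulrAC ler_pdivlMr // mul1r.
have -> : \sum_h lampk finset.setT f0 h * (1 - 4 / (M * #|V|%:R) * ss h ^+ 2) =
    \sum_h lampk finset.setT f0 h -
    4 / (M * #|V|%:R) * \sum_h lampk finset.setT f0 h * ss h ^+ 2.
  by rewrite mulr_sumr -sumrB; apply: eq_bigr => h _; ring.
rewrite lampk_sum1 lerD2l lerN2.
have -> : 4 / M = 4 / (M * #|V|%:R) * #|V|%:R by field; rewrite !gt_eqF.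
rewrite ler_wpM2l //; first by rewrite divr_ge0 // ltW.
apply: le_trans (sqr_ss _) _.
by rewrite /unl finset.setCT cards0 expr0n add0r.
Qed.

Variable q : V -> V -> R.
Hypothesis q_ge0 : forall x y, 0 <= q x y.
Hypothesis q_sum1 : forall x, \sum_y q x y = 1.

(** The vertices whose lamps have been refreshed. It is empty for the empty path: the lamp at the
    start is refreshed only by the first step. *)
Fixpoint rng x (w : seq V) : {set V} :=
  if w is y :: w' then [set x; y] :|: rng y w' else finset.set0.

Lemma rng_sub x w : rng x w \subset [set z in x :: w].
Proof.
elim: w x => [|y w IH] x /=; first exact: finset.sub0set.
apply/fintype.subsetP => z; rewrite !inE => /orP[/orP[] -> //|]; first by rewrite orbT.
by move=> /(fintype.subsetP (IH y)); rewrite !inE => ->; rewrite orbT.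
Qed.

Lemma rngE x y w : rng x (y :: w) = [set z in x :: y :: w].
Proof.
elim: w x y => [|y' w IH] x y.
  by apply/setP => z; rewrite /= !inE orbF.
rewrite -[rng x _]/([set x; y] :|: rng y (y' :: w)) IH.
by apply/setP => z; rewrite !inE -!orbA; case: (z == y); rewrite ?orbT.
Qed.

(** Given the base path, the lamps on it are independent fair bits and the others are unchanged. *)
Lemma step_prob_lamp t f x h y :
  step_prob (lamplighter_walk q) t (f, x) (h, y) =
  Ex q t x (fun w => (last x w == y)%:R * lampk (rng x w) f h).
Proof.
elim: t f x => [|t IH] f x /=.
  by rewrite lampk_set0 xpair_eqE -natrM mulnb andbC.
transitivity (\sum_z \sum_g (q x z * lampk [set x; z] f g) *
    Ex q t z (fun w => (last z w == y)%:R * lampk (rng z w) g h)).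
  rewrite exchange_big pair_big /=; apply: eq_bigr => -[g z] _ /=.
  by rewrite -IH -lamplighter_walkE.
apply: eq_bigr => z _.
under eq_bigr do rewrite -mulrA -ExZ.
rewrite -mulr_sumr; congr (_ * _); rewrite -Ex_sum; apply: eq_Ex => w _.
rewrite -lampk_comp mulr_sumr; apply: eq_bigr => g _; ring.
Qed.

Lemma ler_norm_Ex n x (F : seq V -> R) : `|Ex q n x F| <= Ex q n x (fun w => `|F w|).
Proof.
rewrite ler_norml -[X in X <= _]mulN1r -ExZ.
by rewrite !ler_Ex // => w _; rewrite ?mulN1r ?ler_norm // lerNl -normrN ler_norm.
Qed.

Local Notation unif := (2^-1 ^+ #|V| / #|V|%:R : R).

(** Replacing the lamp law by the uniform one costs nothing on covering paths and mass at most 2 on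
    the others. Time is [t.+1] because no lamp is refreshed at time 0. *)
Lemma lamp_upper t f x : (0 < #|V|)%N ->
  2^-1 * (\sum_v `|step_prob (lamplighter_walk q) t.+1 (f, x) v - unif|) <=
  2^-1 * (\sum_y `|step_prob q t.+1 x y - #|V|%:R^-1|) + tl q t.+1 x finset.setT.
Proof.
move=> V0; have V0' : #|V|%:R != 0 :> R by rewrite pnatr_eq0 -lt0n.
set u0 : R := 2^-1 ^+ #|V|; have u0_ge0 : 0 <= u0 by rewrite exprn_ge0.
have u0_sum : \sum_(h : {ffun V -> bool}) u0 = 1.
  by rewrite -[RHS](lampk_sum1 finset.setT f); apply: eq_bigr => h _; rewrite lampk_setT.
pose bad (x : V) (w : seq V) : R := (~~ ((finset.setT : {set V}) \subset x :: w))%:R.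
have dec h y : `|step_prob (lamplighter_walk q) t.+1 (f, x) (h, y) - u0 / #|V|%:R| <=
    u0 * `|step_prob q t.+1 x y - #|V|%:R^-1| +
    Ex q t.+1 x (fun w => (last x w == y)%:R * (bad x w * (lampk (rng x w) f h + u0))).
  have -> : step_prob (lamplighter_walk q) t.+1 (f, x) (h, y) - u0 / #|V|%:R =
      u0 * (step_prob q t.+1 x y - #|V|%:R^-1) +
      Ex q t.+1 x (fun w => (last x w == y)%:R * (lampk (rng x w) f h - u0)).
    rewrite mulrBr (step_probE q) -ExZ addrAC -ExD step_prob_lamp; congr (_ - _).
    by apply: eq_Ex => w _; ring.
  apply: (le_trans (ler_normD _ _)); apply: lerD; first by rewrite normrM ger0_norm.
  apply: (le_trans (ler_norm_Ex _ _ _)); apply: ler_Ex => // w sw.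
  rewrite normrM ger0_norm // ler_wpM2l // /bad.
  case: (boolP ((finset.setT : {set V}) \subset x :: w)) => cov /=; last first.
    rewrite mul1r; apply: (le_trans (ler_normB _ _)).
    by rewrite !ger0_norm // lampk_ge0.
  rewrite mul0r (_ : rng x w = finset.setT) ?lampk_setT ?subrr ?normr0 //.
  case: w sw cov => // y' w _ cov; rewrite rngE; apply/setP => z.
  by rewrite !inE; have := fintype.subsetP cov z; rewrite !inE => ->.
apply: (@le_trans _ _ (2^-1 * (\sum_h \sum_y (u0 * `|step_prob q t.+1 x y - #|V|%:R^-1| +
    Ex q t.+1 x (fun w => (last x w == y)%:R * (bad x w * (lampk (rng x w) f h + u0))))))).
  rewrite ler_wpM2l // pair_big /=; apply: ler_sum => -[h y] _; exact: dec.
have -> : \sum_h \sum_y (u0 * `|step_prob q t.+1 x y - #|V|%:R^-1| +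
    Ex q t.+1 x (fun w => (last x w == y)%:R * (bad x w * (lampk (rng x w) f h + u0)))) =
    \sum_y `|step_prob q t.+1 x y - #|V|%:R^-1| + 2 * tl q t.+1 x finset.setT.
  under eq_bigr do rewrite big_split -mulr_sumr -Ex_sum.
  rewrite big_split -mulr_suml u0_sum mul1r; congr (_ + _).
  rewrite tlE // -ExZ -Ex_sum; apply: eq_Ex => w _.
  under eq_bigr do rewrite -mulr_suml.
  have -> : \sum_y (last x w == y)%:R = 1 :> R.
    by rewrite (bigD1 (last x w)) //= eqxx big1 ?addr0 // => y; rewrite eq_sym => /negbTE ->.
  under eq_bigr do rewrite mul1r.
  by rewrite -mulr_sumr big_split /= lampk_sum1 u0_sum mulrC.
by rewrite mulrDr mulrA mulVf ?mul1r.
Qed.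

(* Comparison of the event low, typical for uniform lamps but not when many
   lamps are still in their initial state. *)
Lemma lamp_lower (M eps : R) t x : 0 < M -> (0 < #|V|)%N ->
  2^-1 * (\sum_v `|step_prob (lamplighter_walk q) t (f0, x) v - unif|) <= eps ->
  Ex q t x (fun w => (M * #|V|%:R <= #|~: [set z in x :: w]|%:R ^+ 2)%R%:R) <= eps + 8 / M.
Proof.
move=> M0 V0 tv; have V0' : #|V|%:R != 0 :> R by rewrite pnatr_eq0 -lt0n.
set u0 : R := 2^-1 ^+ #|V| in tv *.
pose P v := step_prob (lamplighter_walk q) t (f0, x) v.
have PE h y : P (h, y) = Ex q t x (fun w => (last x w == y)%:R * lampk (rng x w) f0 h).
  exact: step_prob_lamp.
have sum_last w : \sum_y (last x w == y)%:R = 1 :> R.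
  by rewrite (bigD1 (last x w)) //= eqxx big1 ?addr0 // => y; rewrite eq_sym => /negbTE ->.
have P_sum (b : {ffun V -> bool} -> R) : \sum_v b v.1 * P v =
    Ex q t x (fun w => \sum_h lampk (rng x w) f0 h * b h).
  transitivity (\sum_h \sum_y b h * P (h, y)); first by rewrite pair_big; apply: eq_bigr => -[].
  rewrite Ex_sum; apply: eq_bigr => h _; rewrite -mulr_sumr.
  under eq_bigr do rewrite PE.
  rewrite -Ex_sum -ExZ; apply: eq_Ex => w _.
  by rewrite -mulr_suml sum_last mul1r mulrC.
have U_sum (b : {ffun V -> bool} -> R) :
    \sum_(v : {ffun V -> bool} * V) b v.1 * (u0 / #|V|%:R) = \sum_h u0 * b h.
  transitivity (\sum_h \sum_(y : V) b h * (u0 / #|V|%:R)); first by rewrite pair_big.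
  apply: eq_bigr => h _; rewrite sumr_const -[LHS]mulr_natr; field.
  exact: V0'.
pose b h : R := (low M h)%:R.
have key : \sum_h u0 * b h - Ex q t x (fun w => \sum_h lampk (rng x w) f0 h * b h) <= eps.
  apply: le_trans tv; rewrite -U_sum -P_sum -sumrB.
  have zero : \sum_(v : {ffun V -> bool} * V) (u0 / #|V|%:R - P v) = 0.
    rewrite sumrB; apply/eqP; rewrite subr_eq0; apply/eqP.
    have := U_sum (fun=> 1); have := P_sum (fun=> 1).
    under eq_bigr do rewrite mul1r; move=> ->.
    under eq_bigr do rewrite mul1r; move=> ->.
    transitivity (1 : R).
      rewrite -[RHS](lampk_sum1 finset.setT f0); apply: eq_bigr => h _.
      by rewrite lampk_setT mulr1.
    rewrite -[LHS](Ex_cst q_sum1 t x); apply: eq_Ex => w _.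
    by rewrite -[LHS](lampk_sum1 (rng x w) f0); apply: eq_bigr => h _; rewrite mulr1.
  (* Both laws have mass 1, so the indicator may be centred at 1/2; its absolute value 1/2 is the
     factor in total variation. *)
  have -> : \sum_v (b v.1 * (u0 / #|V|%:R) - b v.1 * P v) =
      \sum_v (b v.1 - 2^-1) * (u0 / #|V|%:R - P v).
    transitivity (\sum_v (b v.1 * (u0 / #|V|%:R) - b v.1 * P v) -
      2^-1 * \sum_v (u0 / #|V|%:R - P v)); first by rewrite zero mulr0 subr0.
    by rewrite [2^-1 * _]mulr_sumr -sumrB; apply: eq_bigr => v _; ring.
  rewrite [leRHS]mulr_sumr.
  apply: ler_sum => -[h y] _ /=; rewrite distrC -/(P (h, y)).
  rewrite /b; set z := u0 / _ - P _.
  have z1 : z <= `|z| by exact: ler_norm.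
  have z2 : - z <= `|z| by rewrite -normrN ler_norm.
  case: (low M h); rewrite ?mul1r ?mul0r /=; lra.
have up : Ex q t x (fun w => \sum_h lampk (rng x w) f0 h * b h) <=
    Ex q t x (fun w => 1 + 4 / M - (M * #|V|%:R <= unl (rng x w) ^+ 2)%R%:R).
  apply: ler_Ex => // w _.
  have M4 : 0 <= 4 / M by rewrite divr_ge0 // ltW.
  case: (boolP (M * #|V|%:R <= _)) => hM; first by rewrite addrAC subrr add0r lampk_low.
  rewrite subr0; apply: (@le_trans _ _ 1); last by rewrite lerDl.
  rewrite -(lampk_sum1 (rng x w) f0); apply: ler_sum => h _.
  by rewrite ler_piMr ?lampk_ge0 // /b lern1 leq_b1.
have cov : Ex q t x (fun w => (M * #|V|%:R <= #|~: [set z in x :: w]|%:R ^+ 2)%R%:R) <=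
    Ex q t x (fun w => (M * #|V|%:R <= unl (rng x w) ^+ 2)%R%:R).
  apply: ler_Ex => // w _; apply: ler_nat_bool => /le_trans; apply.
  rewrite ler_sqr ?nnegrE // ler_nat subset_leq_card // finset.setCS.
  exact: rng_sub.
have := unif_low M0 V0; rewrite -/u0 -/(b _) => low_u.
rewrite ExB Ex_cst // in up.
have : 8 / M = 4 / M + 4 / M by field; rewrite gt_eqF.
move: low_u key up cov; rewrite /b; lra.
Qed.

End LampKernel.

(** * Two independent runs *)

Section TwoRuns.
Variables (R : realType) (S : finType) (p : S -> S -> R).
Hypothesis wp : walk p.
Implicit Types (x y z v : S) (w : seq S) (U A : {set S}).
Let p_ge0 := walk_ge0 wp.
Let p_sum1 := walk_sum1 wp.
Let p_trans := walk_trans wp.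

(** By transitivity neither side depends on its base point, and the totals over all base points
    agree. *)
Lemma mass_transport (g : S -> S -> R) :
  (forall s : {perm S}, (forall u v, p (s u) (s v) = p u v) ->
     forall u v, g (s u) (s v) = g u v) ->
  forall v y, \sum_u g u y = \sum_u g v u.
Proof.
move=> g_inv v y.
have S0 : #|S|%:R != 0 :> R by rewrite pnatr_eq0 -lt0n (ltn_trans _ (walk_card wp)).
have s_bij (s : {perm S}) : {on [pred _ | true], bijective s}.
  by exists (s^-1)%g => u _; rewrite ?permK ?permKV.
have c1 y' : \sum_u g u y' = \sum_u g u y.
  have [s [s_p <-]] := p_trans y y'; rewrite (reindex s) //=.
  by apply: eq_bigr => u _; rewrite g_inv.
have c2 v' : \sum_u g v' u = \sum_u g v u.
  have [s [s_p <-]] := p_trans v v'; rewrite (reindex s) //=.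
  by apply: eq_bigr => u _; rewrite g_inv.
apply: (mulIf S0); rewrite !mulr_natr -!sumr_const.
transitivity (\sum_y' \sum_u g u y'); first by apply: eq_bigr => y' _; rewrite c1.
by rewrite exchange_big; apply: eq_bigr => v' _; rewrite c2.
Qed.

Let unv x w : {set S} := ~: [set z in x :: w].
Let small (M : R) x w := #|unv x w|%:R ^+ 2 < M * #|S|%:R.

Let unv_aut (s : {perm S}) x w : unv (s x) (map s w) = s @: unv x w.
Proof.
apply/setP => z; rewrite -[z](permKV s) mem_imset; last exact: perm_inj.
by rewrite !inE -[_ || _]/(_ \in s x :: map s w) -map_cons mem_map //; exact: perm_inj.
Qed.

(** After a good first run only the part of U that it missed remains to be visited. *)
Lemma cv_two_stage (good : seq S -> bool) n m x U (c : R) :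
  (forall w, size w = n -> good w -> c <= cv p m (last x w) (U :\: [set z in x :: w])) ->
  0 <= c -> c * Ex p n x (fun w => (good w)%:R) <= cv p (n + m) x U.
Proof.
move=> good_c c0; rewrite -ExZ /cv Ex_cat; apply: ler_Ex => // w sw.
case: (boolP (good w)) => [gw|_]; last by rewrite mulr0; apply: Ex_ge0.
rewrite mulr1; apply: le_trans (good_c w sw gw) _; apply: ler_Ex => // w' _.
apply: ler_nat_bool => /fintype.subsetP sU; apply/fintype.subsetP => y yU.
rewrite -cat_cons mem_cat; have [//|yw] := boolP (y \in x :: w).
have : y \in U :\: [set z in x :: w] by rewrite !inE -in_cons yw.
move=> /sU; rewrite inE => /orP[/eqP yl|-> //].
by rewrite yl mem_last in yw.
Qed.

Variables (M p0 : R) (t : nat).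
Hypothesis p0_gt0 : 0 < p0.
Hypothesis M_ge0 : 0 <= M.
Hypothesis smallP : forall x, p0 <= Ex p t x (fun w => (small M x w)%:R).

(* Averaging over the starting point: by transitivity the unvisited set of an
   independent run meets A in about #|A| #|unv| / #|S| <= M points. *)
Lemma second_run A L : #|A|%:R ^+ 2 < M * #|S|%:R -> 2 * M <= p0 * L%:R ->
  exists v, p0 / 2 <= Ex p t v (fun w => (#|A :&: unv v w| <= L)%N%:R).
Proof.
move=> A_small ML; apply/not_existsP => none.
have none' v : Ex p t v (fun w => (#|A :&: unv v w| <= L)%N%:R) < p0 / 2.
  by rewrite ltNge; apply/negP; exact: none.
pose g v y := Ex p t v (fun w => (small M v w)%:R * (y \in unv v w)%:R).
have g_inv (s : {perm S}) : (forall u v, p (s u) (s v) = p u v) ->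
    forall u v, g (s u) (s v) = g u v.
  move=> s_p u v; rewrite /g (Ex_aut s_p); last by exists (s^-1)%g; [exact: permK|exact: permKV].
  apply: eq_Ex => w _; rewrite /small unv_aut card_imset; last exact: perm_inj.
  by rewrite mem_imset //; exact: perm_inj.
have inter v w : #|A :&: unv v w|%:R = \sum_(y in A) (y \in unv v w)%:R :> R.
  rewrite -sum1_card natr_sum big_mkcond [RHS]big_mkcond /=.
  by apply: eq_bigr => y _; rewrite finset.in_setI; case: (y \in A); case: (y \in unv v w).
have sum_small v : Ex p t v (fun w => (small M v w)%:R * #|unv v w|%:R) * #|A|%:R <=
    M * #|S|%:R.
  rewrite mulrC -ExZ -[leRHS](Ex_cst p_sum1 t v); apply: ler_Ex => // w _.
  have MS : 0 <= M * #|S|%:R by rewrite mulr_ge0.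
  case: (boolP (small M v w)) => [|_]; last by rewrite mul0r mulr0.
  rewrite /small mul1r => sm; rewrite leNgt; apply/negP => h.
  have a0 : 0 <= #|A|%:R :> R by rewrite ler0n.
  have u0 : 0 <= #|unv v w|%:R :> R by rewrite ler0n.
  move: (#|A|%:R : R) (#|unv v w|%:R : R) A_small sm h a0 u0 => a u; nra.
have [v0 _] : exists v0 : S, true.
  by have := walk_card wp; case: (pickP {: S}) => [x|/eq_card0 ->] //; exists x.
have total : \sum_v Ex p t v (fun w => (small M v w)%:R * #|A :&: unv v w|%:R) <=
    M * #|S|%:R.
  apply: le_trans (sum_small v0).
  have -> : \sum_v Ex p t v (fun w => (small M v w)%:R * #|A :&: unv v w|%:R) =
      \sum_(y in A) \sum_v g v y.
    rewrite exchange_big /=; apply: eq_bigr => v _.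
    transitivity (\sum_y Ex p t v (fun w =>
      (y \in A)%:R * ((small M v w)%:R * (y \in unv v w)%:R))).
      rewrite -Ex_sum; apply: eq_Ex => w _; rewrite inter mulr_sumr big_mkcond /=.
      by apply: eq_bigr => y _; case: (y \in A); rewrite ?mul1r ?mul0r.
    rewrite [RHS]big_mkcond /=; apply: eq_bigr => y _.
    by rewrite ExZ; case: (y \in A); rewrite ?mul1r ?mul0r.
  under eq_bigr do rewrite (mass_transport g_inv v0).
  rewrite sumr_const -[leLHS]mulr_natr ler_wpM2r //.
  rewrite /g -Ex_sum; apply: ler_Ex => // w _; rewrite -mulr_sumr ler_wpM2l //.
  rewrite -sum1_card natr_sum [leRHS]big_mkcond /=.
  by apply: ler_sum => y _; case: (y \in unv v0 w).
have each v : L.+1%:R * (p0 / 2) < Ex p t v (fun w => (small M v w)%:R * #|A :&: unv v w|%:R).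
  have h1 : p0 / 2 < Ex p t v (fun w => (small M v w)%:R - (#|A :&: unv v w| <= L)%N%:R).
    by rewrite ExB; have := smallP v; have := none' v; lra.
  apply: lt_le_trans (_ : L.+1%:R * Ex p t v (fun w => (small M v w)%:R - (#|A :&: unv v w| <= L)%N%:R) <= _).
    by rewrite ltr_pM2l ?ltr0n.
  rewrite -ExZ; apply: ler_Ex => // w _.
  case: (small M v w); case: leqP => cA; rewrite /= ?mul1r ?mul0r ?subrr ?subr0 ?sub0r ?mulr0 ?mulr1 ?ler0n //.
    by rewrite ler_nat.
have S0 : 0 < #|S|%:R :> R by rewrite ltr0n (ltn_trans _ (walk_card wp)).
have : #|S|%:R * (L.+1%:R * (p0 / 2)) <= M * #|S|%:R.
  apply: le_trans total; rewrite mulr_natl -sumr_const; apply: ler_sum => v _.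
  exact/ltW/each.
rewrite mulrC ler_pM2r // => ub; have {}ub : (L%:R + 1) * (p0 / 2) <= M by rewrite natr1.
have := p0_gt0; nra.
Qed.

(** A good run (p0), a trip to the vertex of [second_run] (1/2), a second run missing at most L
    common vertices (p0/2), then a search for each of these (1/2 each). *)
Lemma two_runs m L x : 2 * M <= p0 * L%:R -> (forall x y, 1 / 2 <= cv p m x [set y]) ->
  p0 ^+ 2 / 4 * (1 / 2) ^+ L <= cv p (t + (m + (t + L * m))) x finset.setT.
Proof.
move=> ML m_hit.
have h0 : 0 <= (1 / 2) ^+ L :> R by rewrite exprn_ge0.
have last_run U z : (#|U| <= L)%N -> (1 / 2) ^+ L <= cv p (L * m) z U.
  move=> UL; apply: (@le_trans _ _ ((1 / 2) ^+ #|U|)).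
    by rewrite ler_wiXn2l //; lra.
  apply: le_trans (cv_iter p_ge0 p_sum1 U z _ m_hit) _ => //.
  by apply: cv_homo => //; rewrite leq_mul2r UL orbT.
have c0 : 0 <= 1 / 2 * (p0 / 2 * (1 / 2) ^+ L).
  by rewrite !mulr_ge0 // ?invr_ge0 // ltW.
apply: (@le_trans _ _ ((1 / 2 * (p0 / 2 * (1 / 2) ^+ L)) *
   Ex p t x (fun w => (small M x w)%:R))).
  apply: (@le_trans _ _ ((1 / 2 * (p0 / 2 * (1 / 2) ^+ L)) * p0)); last by rewrite ler_wpM2l.
  by rewrite le_eqVlt; apply/orP; left; apply/eqP; field.
apply: (cv_two_stage (good := small M x)) => // w sw sm.
rewrite finset.setTD -/(unv x w).
have [v hv] := second_run sm ML.
have h2 : p0 / 2 * (1 / 2) ^+ L <= cv p (t + L * m) v (unv x w).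
  apply: (@le_trans _ _ ((1 / 2) ^+ L *
      Ex p t v (fun w' => (#|unv x w :&: unv v w'| <= L)%N%:R))).
    by rewrite mulrC ler_wpM2l.
  apply: cv_two_stage => // w' sw'; rewrite /unv -finset.setDE => UL.
  exact: last_run.
apply: le_trans (cv_markov1 p_ge0 p_sum1 m (t + L * m) _ v _).
apply: ler_pM => //.
by rewrite mulr_ge0 // divr_ge0 // ltW.
Qed.

(** By mass transport, more than p0 N / 4 vertices reach y within t steps with probability at least
    p0 / 4. A good run misses too few vertices to avoid them all, so y is hit within 2t steps with
    probability p0^2 / 4 from anywhere. *)
Lemma thit_le : 16 * M <= p0 ^+ 2 * #|S|%:R -> thit p <= 8 / p0 ^+ 2 * t%:R.
Proof.
move=> ML; have S0 : 0 < #|S|%:R :> R by rewrite ltr0n (ltn_trans _ (walk_card wp)).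
have p1 : p0 <= 1.
  have [x _] : exists v0 : S, true.
    by have := walk_card wp; case: (pickP {: S}) => [x|/eq_card0 ->] //; exists x.
  apply: le_trans (smallP x) _; rewrite -[leRHS](Ex_cst p_sum1 t x).
  by apply: ler_Ex => // w _; rewrite lern1 leq_b1.
have small_le x w : small M x w -> #|unv x w|%:R <= p0 * #|S|%:R / 4.
  rewrite /small => sm; rewrite leNgt; apply/negP => h.
  have : 16 * (M * #|S|%:R) <= (p0 * #|S|%:R) ^+ 2.
    by rewrite mulrA exprMn expr2 [_ * _ * (_ * _)]mulrA ler_wpM2r // ltW.
  have : 0 <= p0 * #|S|%:R by rewrite mulr_ge0 // ltW.
  move: (p0 * #|S|%:R) (#|unv x w|%:R : R) h sm => a u; nra.
have visits x : 3 / 4 * (p0 * #|S|%:R) <= \sum_y cv p t x [set y].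
  under eq_bigr do rewrite cv1E.
  rewrite -Ex_sum; apply: (@le_trans _ _ (3 / 4 * #|S|%:R * Ex p t x (fun w => (small M x w)%:R))).
    by rewrite [p0 * _]mulrC mulrA ler_wpM2l // mulr_ge0 ?ler0n //; lra.
  rewrite -ExZ; apply: ler_Ex => // w _.
  have -> : \sum_y (y \in x :: w)%:R = #|S|%:R - #|unv x w|%:R :> R.
    rewrite -(cardsC [set z in x :: w]) natrD addrK -sum1_card natr_sum [RHS]big_mkcond /=.
    by apply: eq_bigr => y _; rewrite inE; case: (y \in _).
  have uS : #|unv x w|%:R <= #|S|%:R :> R by rewrite ler_nat max_card.
  case: (boolP (small M x w)) => [/small_le|_]; last by rewrite mulr0; lra.
  have : p0 * #|S|%:R <= #|S|%:R by rewrite ler_piMl // ltW.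
  rewrite mulr1; lra.
have hit x y : p0 ^+ 2 / 4 <= cv p (t + t) x [set y].
  pose W := [set z | p0 / 4 <= cv p t z [set y]]%SET.
  have W_big : p0 * #|S|%:R / 4 < #|W|%:R.
    have : 3 / 4 * (p0 * #|S|%:R) <= \sum_z cv p t z [set y].
      rewrite (@mass_transport (fun z y => cv p t z [set y]) _ x y) //.
      move=> s s_p u v; apply: cv_aut1 => //.
      by exists (s^-1)%g; [exact: permK|exact: permKV].
    have : \sum_z cv p t z [set y] <= #|W|%:R + #|S|%:R * (p0 / 4).
      have -> : #|S|%:R * (p0 / 4) = \sum_(z : S) p0 / 4 by rewrite sumr_const mulr_natl.
      have -> : #|W|%:R = \sum_z (z \in W)%:R :> R.
        by rewrite -sum1_card natr_sum big_mkcond /=; apply: eq_bigr => z _; case: (z \in W).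
      rewrite -big_split /=; apply: ler_sum => z _.
      rewrite inE; case: (lerP (p0 / 4)) => [_|/ltW]; last by rewrite add0r.
      by apply: (le_trans (cv_le1 p_ge0 p_sum1 t z [set y])); rewrite lerDl divr_ge0 // ltW.
    have : 0 < p0 * #|S|%:R by rewrite mulr_gt0.
    lra.
  have p4 : 0 <= p0 / 4 by rewrite divr_ge0 // ltW.
  apply: le_trans (@cv_markov _ _ p p_ge0 p_sum1 (fun z => z \in W) t t x [set y] _ p4 _); last first.
    by move=> z; rewrite inE.
  have -> : p0 ^+ 2 / 4 = p0 / 4 * p0 by field.
  rewrite ler_wpM2l //; apply: le_trans (smallP x) _; apply: ler_Ex => // w _.
  apply: ler_nat_bool => /small_le sm; apply/negPn/negP => /hasPn noW.
  have : (#|W| <= #|unv x w|)%N.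
    apply: subset_leq_card; apply/fintype.subsetP => z zW; rewrite finset.in_setC inE.
    by apply/negP => /noW; rewrite /= zW.
  by rewrite -(ler_nat R) => /(lt_le_trans W_big)/lt_le_trans/(_ sm); rewrite ltxx.
apply: bigmax_le => [|[x y] _ /=]; first by rewrite mulr_ge0 ?divr_ge0 ?sqr_ge0.
apply: (ht_le p_ge0 p_sum1 (walk_bounded wp)) => n.
apply: le_trans (hs_bound p_ge0 p_sum1 n x _ (hit^~ y)) _.
  by rewrite divr_gt0 // exprn_gt0.
by rewrite natrD le_eqVlt; apply/orP; left; apply/eqP; field; rewrite gt_eqF.
Qed.

End TwoRuns.

(** * Transitive graphs *)

Section SimpleRandomWalk.
Variables (R : realType) (G : fin_graph).
Hypothesis G_connected : graph_connected G.
Hypothesis G_transitive : vertex_transitive G.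
Hypothesis G_aperiodic : aperiodic (@srw R G).
Hypothesis G_card : (1 < #|G|)%N.

Let deg (x : G) := #|[pred z : G | adj x z]|.

Let deg_aut (s : {perm G}) :
  (forall u v : G, adj (s u) (s v) = adj u v) -> forall x, deg (s x) = deg x.
Proof.
move=> s_adj x; rewrite /deg -(fintype.card_image (@perm_inj _ s) [pred z | adj x z]).
apply: eq_card => z; rewrite !inE -[z](permKV s) fintype.mem_image ?inE ?s_adj //.
exact: perm_inj.
Qed.

Let deg_const x y : deg x = deg y.
Proof. by have [s [s_adj <-]] := G_transitive x y; rewrite deg_aut. Qed.

Let deg_gt0 x : (0 < deg x)%N.
Proof.
have [y yx] : exists y, y != x.
  apply/existsP; rewrite -negb_forall; apply/negP => /forallP all_x.
  suff : (#|G| <= 1)%N by rewrite leqNgt G_card.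
  by apply/card_le1_eqP => u v _ _; rewrite (eqP (all_x u)) (eqP (all_x v)).
have /connectP[[|z w] /= path_w last_w] := G_connected x y.
  by rewrite last_w eqxx in yx.
by apply/card_gt0P; exists z; rewrite inE; case/andP: path_w.
Qed.

Let degR_gt0 x : 0 < (deg x)%:R :> R.
Proof. by rewrite ltr0n. Qed.

Lemma srw_walk : walk (@srw R G).
Proof.
have srw_sum1 (x : G) : \sum_y srw R x y = 1.
  rewrite /srw -mulr_suml -/(deg x).
  have -> : \sum_(y : G) (adj x y)%:R = (deg x)%:R :> R.
    by rewrite /deg -sum1_card natr_sum [RHS]big_mkcond; apply: eq_bigr => y _; rewrite inE; case: adj.
  by rewrite mulfV // gt_eqF.
have srw_ge0 (x y : G) : 0 <= srw R x y by rewrite /srw divr_ge0.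
have srw_gt0 (x y : G) : adj x y -> (deg x)%:R^-1 = srw R x y.
  by rewrite /srw => ->; rewrite mul1r.
split=> //.
- by move=> x y; rewrite /srw -/(deg x) -/(deg y) (deg_const x y) adj_sym.
- move=> x y; have [s [s_adj sx]] := G_transitive x y; exists s; split=> // u v.
  by rewrite /srw -/(deg (s u)) -/(deg u) deg_aut // s_adj.
- move=> x y; have /connectP[w + ->] := G_connected x y.
  elim: w x => [|z w IH] x /=; first by exists 0%N; rewrite /= eqxx ltr01.
  case/andP => xz /IH[n n_pos]; exists n.+1 => /=.
  rewrite (bigD1 z) //= ltr_wpDr //; last by rewrite mulr_gt0 // -srw_gt0 // invr_gt0.
  by apply: sumr_ge0 => u _; rewrite mulr_ge0 // step_prob_ge0.
- move=> x y; have [xy _|xy] := boolP (adj x y); last first.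
    by rewrite /srw (negbTE xy) mul0r ltxx.
  by rewrite -srw_gt0 // lef_pV2 ?posrE ?ltr0n // ?(ltn_trans _ G_card) // ler_nat max_card.
Qed.

End SimpleRandomWalk.

(** * Cover times of a transitive walk *)

Section WalkCover.
Variables (R : realType) (S : finType) (p : S -> S -> R).
Hypothesis wp : walk p.
Let p_ge0 := walk_ge0 wp.
Let p_sum1 := walk_sum1 wp.
Let bnd := walk_bounded wp.
Local Notation full := (finset.setT : {set S}).
Local Notation EC := (hmax p full).

Lemma ht_full x : ht p x full = EC.
Proof.
suff ht_const y : ht p y full = ht p x full.
  apply/eqP; rewrite eq_le (ht_hmax p x full) /=; apply: hmax_le.
    exact: (ht_ge0 p_ge0 p_sum1 bnd x full).
  by move=> y; rewrite ht_const.
have [s [s_p <-]] := walk_trans wp x y.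
have s_full : s @: full = full.
  by apply/setP => z; rewrite inE -[z](permKV s) imset_f ?inE.
congr (limn _); apply/funext => n; apply: eq_bigr => k _.
rewrite /tl -[in LHS]s_full cv_aut //.
by exists (s^-1)%g; [exact: permK|exact: permKV].
Qed.

Lemma thit_le_EC : thit p <= EC.
Proof.
apply: bigmax_le => [|[x y] _ /=]; first exact: hmax_ge0.
by rewrite -(ht_full x); apply: ht_subset => //; exact: finset.subsetT.
Qed.

Lemma EC_gt0 : 1 / 2 <= EC.
Proof. exact: le_trans (thit_gt0 wp) thit_le_EC. Qed.

Lemma cover_markov n x : n.+1%:R * tl p n x full <= EC.
Proof. by rewrite -(ht_full x); exact: tl_markov. Qed.

Lemma cover_upper n x : EC <= n%:R ->
  tl p n x full * (n%:R - EC) ^+ 2 <= 2 * thit p * EC.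
Proof.
move=> ECn.
have := chebyshev_upper p_ge0 p_sum1 bnd (ht_thit p) (n := n) (x := x) (U := full).
by rewrite ht_full; exact.
Qed.

Lemma cover_lower n x : n%:R <= EC ->
  cv p n x full * (n%:R - EC) ^+ 2 <= 2 * thit p * EC.
Proof.
move=> ECn.
have := chebyshev_lower p_ge0 p_sum1 bnd (ht_thit p) (n := n) (x := x) (U := full).
by rewrite ht_full; exact.
Qed.

End WalkCover.

(** Distance to the uniform law, with which [lamp_stationary] identifies any stationary law. *)
Definition lamp_tv (R : realType) (S : finType) (p : S -> S -> R) (t : nat) (eps : R) :=
  forall u, 2^-1 * (\sum_v `|step_prob (lamplighter_walk p) t u v -
    2^-1 ^+ #|S| / #|S|%:R|) <= eps.

(** One d pays for the mixing of the base walk, the other for uncovered vertices. *)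
Lemma lamp_tv_upper (R : realType) (d : R) : 0 < d <= 1 ->
  exists2 K : R, 0 < K & forall (S : finType) (p : S -> S -> R), walk p ->
    forall t, (0 < t)%N -> K * thit p <= t%:R ->
    (forall x, tl p t x finset.setT <= d) -> lamp_tv p t (2 * d).
Proof.
move=> d01; have [K K0 hK] := walk_mixing d01.
exists K => // S p wp [//|t] _ Kt tl_t [f x].
have S0 : (0 < #|S|)%N := ltn_trans (ltn0Sn 0) (walk_card wp).
apply: le_trans (lamp_upper (walk_ge0 wp) (walk_sum1 wp) t f x S0) _.
have := hK S p wp _ Kt x; have := tl_t x; lra.
Qed.

(** * The stationary law of the lamplighter walk and its mixing time *)

Section Stationary.
Variables (R : realType) (S : finType) (p : S -> S -> R) (mu : {ffun S -> bool} * S -> R).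
Hypothesis wp : walk p.
Hypothesis mu_stat : stationary (lamplighter_walk p) mu.

Lemma stationary_step t v : \sum_u mu u * step_prob (lamplighter_walk p) t u v = mu v.
Proof.
have [_ _ mu_inv] := mu_stat; elim: t => [|t IH] /=.
  rewrite (bigD1 v) //= eqxx mulr1 big1 ?addr0 // => u /negbTE ->.
  by rewrite mulr0.
rewrite -[RHS]IH; under eq_bigr do rewrite mulr_sumr.
rewrite exchange_big /=; apply: eq_bigr => z _; rewrite -(mu_inv z) mulr_suml.
by apply: eq_bigr => u _; rewrite mulrA.
Qed.

(** A stationary law is an average of t-step laws, and these are all close to uniform for large
    t. *)
Lemma lamp_stationary v : mu v = 2^-1 ^+ #|S| / #|S|%:R.
Proof.
have [mu_ge0 mu_sum1 _] := mu_stat.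
suff close (d : R) : 0 < d <= 1 -> `|mu v - 2^-1 ^+ #|S| / #|S|%:R| <= 4 * d.
  apply/eqP; rewrite -subr_eq0 -normr_le0; apply/ler_addgt0Pr => e e0; rewrite add0r.
  have e4 : 0 < e / 4 by rewrite divr_gt0.
  apply: le_trans (close (Num.min (e / 4) 1) _) _.
    by rewrite lt_min ge_min lexx orbT e4 ltr01.
  by rewrite mulrC -ler_pdivlMr // ge_min lexx.
move=> d01; have [K K0 hK] := lamp_tv_upper d01.
have d0 : 0 < d by case/andP: d01.
set EC := hmax p finset.setT.
have EC0 := EC_gt0 wp; rewrite -/EC in EC0.
have T0 := thit_gt0 wp.
(* The first term lets the base walk mix; the second brings the tail of the cover time below d by
   Markov's inequality. *)
pose B := K * thit p + EC / d.
have KT0 : 0 <= K * thit p by apply: mulr_ge0; lra.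
have ECd0 : 0 <= EC / d by apply: divr_ge0; lra.
pose t := (Num.trunc B).+1.
have Bt : B <= t%:R by rewrite ltW // truncnS_gt.
have K_t : K * thit p <= t%:R.
  by apply: le_trans Bt; rewrite lerDl.
have tl_t x : tl p t x finset.setT <= d.
  have := cover_markov wp t x; rewrite -/EC -natr1.
  have ECt : EC / d <= t%:R by apply: le_trans Bt; rewrite lerDr.
  rewrite ler_pdivrMr // in ECt => h; rewrite leNgt; apply/negP => dt.
  have t0 : 0 <= t%:R :> R by rewrite ler0n.
  have : (t%:R + 1) * d < (t%:R + 1) * tl p t x finset.setT by rewrite ltr_pM2l //; lra.
  lra.
have {}hK := hK _ _ wp t (ltn0Sn _) K_t tl_t.
set U := 2^-1 ^+ #|S| / #|S|%:R in hK *.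
have -> : mu v - U = \sum_u mu u * (step_prob (lamplighter_walk p) t u v - U).
  under eq_bigr do rewrite mulrBr.
  by rewrite sumrB stationary_step -mulr_suml mu_sum1 mul1r.
apply: le_trans (ler_norm_sum _ _ _) _.
rewrite -[leRHS]mul1r -[X in _ <= X * _]mu_sum1 mulr_suml; apply: ler_sum => u _.
rewrite normrM ger0_norm // ler_wpM2l //.
apply: (@le_trans _ _ (\sum_v `|step_prob (lamplighter_walk p) t u v - U|)).
  by rewrite [leRHS](bigD1 v) //= lerDl sumr_ge0.
have := hK u; rewrite -/U; lra.
Qed.

Let muE : mu = fun=> 2^-1 ^+ #|S| / #|S|%:R.
Proof. by apply/funext => v; exact: lamp_stationary. Qed.

Lemma mixing_time_le (eps : R) t : lamp_tv p t eps ->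
  (mixing_time (lamplighter_walk p) mu eps <= t%:R%:E)%E.
Proof. by move=> tv; rewrite muE; apply: ereal_inf_lbound; exists t. Qed.

Lemma mixing_time_ge (eps a : R) : (forall t, lamp_tv p t eps -> a <= t%:R) ->
  (a%:E <= mixing_time (lamplighter_walk p) mu eps)%E.
Proof.
move=> ha; rewrite muE; apply: le_ereal_inf_tmp => _ [t /= tv <-].
by rewrite lee_fin; exact: ha.
Qed.

End Stationary.

(** * Mixing bounds for a single walk, with constants depending on eps *)

Section PerGraph.
Variables (R : realType) (eps : R).
Hypothesis eps01 : 0 < eps < 1.
Local Notation EC p := (hmax p finset.setT).

Lemma lamp_mixing : exists2 K : R, 0 < K &
  forall (S : finType) (p : S -> S -> R), walk p ->
    forall t, (0 < t)%N -> K * thit p <= t%:R ->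
    (forall x, tl p t x finset.setT <= eps / 2) -> lamp_tv p t eps.
Proof.
have /andP[eps0 eps1] := eps01.
have [|K K0 hK] := @lamp_tv_upper R (eps / 2); first by apply/andP; split; lra.
exists K => // S p wp t t0 Kt tl_t.
have -> : eps = 2 * (eps / 2) by field.
exact: hK.
Qed.

Lemma lamp_upper_EC : exists2 c : R, 0 < c &
  forall (S : finType) (p : S -> S -> R), walk p ->
    exists2 t, lamp_tv p t eps & t%:R <= c * EC p.
Proof.
have /andP[eps0 eps1] := eps01.
have [K K0 hK] := lamp_mixing.
have e2 : 0 < 2 / eps by rewrite divr_gt0.
(* The last 2 absorbs rounding up to an integer, as the expected cover time is at least 1/2. *)
exists (K + 2 / eps + 2) => [|S p wp]; first by lra.
have E0 := EC_gt0 wp; have T0 := thit_gt0 wp; have TE := thit_le_EC wp.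
set E := EC p in E0 TE *.
pose B := (K + 2 / eps) * E; pose t := (Num.trunc B).+1.
have B0 : 0 <= B by apply: mulr_ge0; lra.
have Bt : B <= t%:R by rewrite ltW // truncnS_gt.
have tB : t%:R <= B + 1.
  have h : (Num.trunc B)%:R <= B by rewrite truncn_le.
  by rewrite /t -natr1; lra.
exists t; last by apply: le_trans tB _; rewrite /B; lra.
apply: hK => // [|x].
  apply: le_trans Bt; rewrite /B mulrDl.
  have h1 : K * thit p <= K * E by rewrite ler_pM2l.
  have h2 : 0 <= 2 / eps * E by rewrite mulr_ge0 // ?ltW //; lra.
  lra.
have := cover_markov wp t x; rewrite -/E -natr1.
have ECt : E * 2 / eps <= t%:R.
  apply: le_trans Bt; rewrite /B mulrDl.
  have h1 : 0 <= K * E by apply: mulr_ge0; lra.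
  have -> : E * 2 / eps = 2 / eps * E by field; rewrite gt_eqF.
  lra.
rewrite ler_pdivrMr // in ECt => h; rewrite leNgt; apply/negP => dt.
have t0 : 0 <= t%:R :> R by rewrite ler0n.
have h3 : (t%:R + 1) * (eps / 2) < (t%:R + 1) * tl p t x finset.setT.
  by rewrite ltr_pM2l //; lra.
lra.
Qed.

(* Total variation at most eps leaves few unvisited vertices with probability
   at least p0, from every starting point; two_runs then covers the graph. *)
Lemma lamp_lower_cover : exists c C N0 : R, [/\ 0 < c, 0 < C &
  forall (S : finType) (p : S -> S -> R), walk p -> N0 <= #|S|%:R ->
    forall t, lamp_tv p t eps -> thit p <= C * t%:R /\
      exists n, n%:R <= 2 * t%:R + C * thit p /\
                forall x, c <= cv p n x finset.setT].
Proof.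
have /andP[eps0 eps1] := eps01.
(* M is chosen so that 1 - eps - 8/M = p0. *)
pose p0 := (1 - eps) / 2; pose M := 16 / (1 - eps).
have e1 : 0 < 1 - eps by lra.
have p0_gt0 : 0 < p0 by rewrite divr_gt0.
have M0 : 0 < M by rewrite divr_gt0.
pose L := (Num.trunc (2 * M / p0)).+1.
have ML : 2 * M <= p0 * L%:R.
  by rewrite [p0 * _]mulrC -ler_pdivrMr // ltW // truncnS_gt.
exists (p0 ^+ 2 / 4 * (1 / 2) ^+ L), (8 / p0 ^+ 2 + 4 * (L%:R + 1)), (16 * M / p0 ^+ 2).
have q0 : 0 < 8 / p0 ^+ 2 by rewrite divr_gt0 // exprn_gt0.
have L0 : 0 <= L%:R :> R by rewrite ler0n.
split; first by rewrite mulr_gt0 ?exprn_gt0 ?divr_gt0 ?exprn_gt0.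
  by lra.
move=> S p wp NS t tv.
have p_ge0 := walk_ge0 wp; have p_sum1 := walk_sum1 wp.
have S0 : (0 < #|S|)%N := ltn_trans (ltn0Sn 0) (walk_card wp).
have smallP x : p0 <= Ex p t x
    (fun w => (#|~: [set z in x :: w]|%:R ^+ 2 < M * #|S|%:R)%R%:R).
  have := lamp_lower p_ge0 p_sum1 M0 S0 (tv (_, x)).
  have -> : 8 / M = (1 - eps) / 2 by rewrite /M; field; rewrite gt_eqF.
  have -> : Ex p t x (fun w => (#|~: [set z in x :: w]|%:R ^+ 2 < M * #|S|%:R)%R%:R) =
      1 - Ex p t x (fun w => (M * #|S|%:R <= #|~: [set z in x :: w]|%:R ^+ 2)%R%:R) :> R.
    rewrite -[X in _ = X - _](Ex_cst p_sum1 t x) -ExB; apply: eq_Ex => w _.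
    by rewrite ltNge; case: (_ <= _); rewrite /= ?subrr ?subr0.
  by rewrite /p0; lra.
have T0 := thit_gt0 wp.
have thit_t : thit p <= 8 / p0 ^+ 2 * t%:R.
  apply: (thit_le wp p0_gt0 smallP).
  by rewrite [p0 ^+ 2 * _]mulrC -ler_pdivrMr // exprn_gt0.
have t0 : 0 <= t%:R :> R by rewrite ler0n.
split.
  apply: le_trans thit_t _; rewrite ler_wpM2r //; lra.
pose m := (Num.trunc (2 * thit p)).+1.
have m_up : m%:R <= 4 * thit p.
  have h : (Num.trunc (2 * thit p))%:R <= 2 * thit p by rewrite truncn_le // mulr_ge0 //; lra.
  by rewrite /m -natr1; lra.
have m_low : 2 * thit p <= m%:R by rewrite ltW // truncnS_gt.
have m_hit x y : 1 / 2 <= cv p m x [set y].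
  have -> : 1 / 2 = 1 - 1 / 2 :> R by field.
  by apply: cv_thit => //; lra.
exists (t + (m + (t + L * m)))%N; split; last first.
  by move=> x; apply: (two_runs wp p0_gt0 (ltW M0) smallP).
rewrite !natrD natrM.
have h1 : L%:R * m%:R <= L%:R * (4 * thit p) by rewrite ler_wpM2l.
have h2 : 0 <= 8 / p0 ^+ 2 * thit p by apply: mulr_ge0; lra.
lra.
Qed.

(** Repeated trials give EC <= n / c, and n <= 2t + C [thit] <= (2 + C^2) t. *)
Lemma lamp_lower_EC : exists c N0 : R, 0 < c /\
  forall (S : finType) (p : S -> S -> R), walk p -> N0 <= #|S|%:R ->
    forall t, lamp_tv p t eps -> c * EC p <= t%:R.
Proof.
have /andP[eps0 eps1] := eps01.
have [c [C [N0 [c0 C0 hc]]]] := lamp_lower_cover.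
have D0 : 0 < 2 + C * C by rewrite ltr_wpDr // mulr_ge0 // ltW.
exists (c / (2 + C * C)), N0; split; first by rewrite divr_gt0.
move=> S p wp NS t tv; have [thit_t [n [n_up n_cov]]] := hc S p wp NS t tv.
have EC_n : EC p <= n%:R / c.
  apply: hmax_le => [|x]; first by rewrite divr_ge0 // ltW.
  apply: (ht_le (walk_ge0 wp) (walk_sum1 wp) (walk_bounded wp)) => k.
  exact: (hs_bound (walk_ge0 wp) (walk_sum1 wp) k x c0 n_cov).
rewrite ler_pdivlMr // in EC_n.
rewrite mulrAC ler_pdivrMr //.
have h : C * thit p <= C * (C * t%:R) by rewrite ler_pM2l.
lra.
Qed.

Lemma lamp_sharp_upper (d : R) : 0 < d -> exists2 eta : R, 0 < eta &
  forall (S : finType) (p : S -> S -> R), walk p -> thit p <= eta * EC p ->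
    exists2 t, lamp_tv p t eps & t%:R <= (1 + d) * EC p.
Proof.
have /andP[eps0 eps1] := eps01.
move=> d0; have [K K0 hK] := lamp_mixing.
(* The three terms ensure K [thit] <= EC, then d EC >= 2 for rounding, then a Chebyshev tail of at
   most eps / 2 at (1 + d/2) EC. *)
pose eta := Num.min (K^-1) (Num.min (d / 4) (eps * d ^+ 2 / 16)).
have eta0 : 0 < eta.
  by rewrite !lt_min invr_gt0 K0 !divr_gt0 // mulr_gt0 // exprn_gt0.
have etaK : K * eta <= 1.
  by rewrite mulrC -ler_pdivlMr // div1r ge_min lexx.
have eta_d : eta <= d / 4 by rewrite !ge_min lexx orbT.
have eta_e : eta <= eps * d ^+ 2 / 16 by rewrite !ge_min lexx !orbT.
exists eta => // S p wp T_small.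
have E0 := EC_gt0 wp; have T0 := thit_gt0 wp; set E := EC p in E0 T_small *.
have Epos : 0 < E by lra.
have dE : 2 <= d * E.
  have h : eta * E <= d / 4 * E by rewrite ler_pM2r.
  lra.
pose B := (1 + d / 2) * E; pose t := (Num.trunc B).+1.
have B0 : 0 <= B by apply: mulr_ge0; lra.
have Bt : B <= t%:R by rewrite ltW // truncnS_gt.
have tB : t%:R <= B + 1.
  have h : (Num.trunc B)%:R <= B by rewrite truncn_le.
  by rewrite /t -natr1; lra.
exists t; last by apply: le_trans tB _; rewrite /B; lra.
apply: hK => // [|x].
  have h1 : K * thit p <= K * (eta * E) by rewrite ler_pM2l.
  have h2 : K * eta * E <= 1 * E by rewrite ler_pM2r.
  apply: le_trans Bt; rewrite /B; lra.
have tE : E <= t%:R by apply: le_trans Bt; rewrite /B; lra.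
have tail0 := tl_ge0 (walk_ge0 wp) (walk_sum1 wp) t x finset.setT.
have := cover_upper wp x tE; rewrite -/E => cheb.
have gap : (d / 2 * E) ^+ 2 <= (t%:R - E) ^+ 2.
  rewrite ler_sqr ?nnegrE; [|by apply: mulr_ge0; lra|lra].
  by move: Bt; rewrite /B; lra.
have h1 : tl p t x finset.setT * (d / 2 * E) ^+ 2 <= 2 * thit p * E.
  by apply: le_trans cheb; rewrite ler_wpM2l.
have h2 : 2 * thit p * E <= 2 * (eta * E) * E by rewrite ler_pM2r // ler_pM2l.
have h3 : 2 * (eta * E) * E <= eps / 2 * (d / 2 * E) ^+ 2.
  have -> : eps / 2 * (d / 2 * E) ^+ 2 = 2 * (eps * d ^+ 2 / 16 * E) * E by field.
  by rewrite ler_pM2r // ler_pM2l // ler_pM2r.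
have h4 : tl p t x finset.setT * (d / 2 * E) ^+ 2 <= eps / 2 * (d / 2 * E) ^+ 2.
  exact: le_trans h1 (le_trans h2 h3).
by move: h4; rewrite ler_pM2r // exprn_gt0 // mulr_gt0 // divr_gt0.
Qed.

(** Covering within n = 2t + O([thit]) steps with probability c is incompatible with concentration
    unless n >= (1 - d) EC; the two runs account for the factor 1/2. *)
Lemma lamp_sharp_lower (d : R) : 0 < d -> exists eta N0 : R, 0 < eta /\
  forall (S : finType) (p : S -> S -> R), walk p -> N0 <= #|S|%:R ->
    thit p <= eta * EC p -> forall t, lamp_tv p t eps -> (1 / 2 - d) * EC p <= t%:R.
Proof.
have /andP[eps0 eps1] := eps01.
move=> d0; have [c [C [N0 [c0 C0 hc]]]] := lamp_lower_cover.
(* The first term makes C [thit] <= d EC; the second makes the Chebyshev bound at (1 - d) EC at most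
   c / 2. *)
pose eta := Num.min (d / C) (c * d ^+ 2 / 4).
have eta0 : 0 < eta by rewrite lt_min !divr_gt0 // mulr_gt0 // exprn_gt0.
have eta_d : C * eta <= d by rewrite mulrC -ler_pdivlMr // ge_min lexx.
have eta_c : eta <= c * d ^+ 2 / 4 by rewrite ge_min lexx orbT.
exists eta, N0; split=> // S p wp NS T_small t tv.
have [_ [n [n_up n_cov]]] := hc S p wp NS t tv.
have E0 := EC_gt0 wp; have T0 := thit_gt0 wp; set E := EC p in E0 T_small *.
have Epos : 0 < E by lra.
have n_low : (1 - d) * E <= n%:R.
  rewrite leNgt; apply/negP => nE.
  have [x _] : exists v0 : S, true.
    by have := walk_card wp; case: (pickP {: S}) => [x|/eq_card0 ->] //; exists x.
  have dE : 0 < d * E by rewrite mulr_gt0.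
  have nE' : n%:R <= E by lra.
  have := cover_lower wp x nE'; rewrite -/E => cheb.
  have gap : (d * E) ^+ 2 <= (n%:R - E) ^+ 2.
    rewrite -[(n%:R - E) ^+ 2]sqrrN ler_sqr ?nnegrE; [|lra|lra].
    lra.
  have h1 : c * (d * E) ^+ 2 <= 2 * thit p * E.
    apply: le_trans cheb; apply: ler_pM => //; [exact: ltW|exact: sqr_ge0].
  have h2 : 2 * thit p * E <= 2 * (eta * E) * E by rewrite ler_pM2r // ler_pM2l.
  have h3 : 2 * (eta * E) * E <= 2 * (c * d ^+ 2 / 4 * E) * E.
    by rewrite ler_pM2r // ler_pM2l // ler_pM2r.
  have h4 : 2 * (c * d ^+ 2 / 4 * E) * E = c * (d * E) ^+ 2 / 2 by field.
  have h5 : 0 < c * (d * E) ^+ 2 by rewrite mulr_gt0 // exprn_gt0.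
  lra.
have h1 : C * thit p <= C * (eta * E) by rewrite ler_pM2l.
have h2 : C * eta * E <= d * E by rewrite ler_pM2r.
lra.
Qed.

End PerGraph.

(** * From eventual bounds to o(1) terms *)

Section Ratio.
Variable R : realType.
Local Open Scope classical_set_scope.

(* A family of eventual (1 + d)-bounds, one for each d > 0, as a single o(1). *)
Lemma ratio_upper (E T : nat -> \bar R) (c : R) :
  (\forall n \near \oo, exists2 r : R, 0 < r & E n = r%:E) ->
  (\forall n \near \oo, (0 <= T n)%E) ->
  (forall d : R, 0 < d -> \forall n \near \oo, (T n <= (c + d)%:E * E n)%E) ->
  exists2 e : nat -> R, e n @[n --> \oo] --> 0 &
    \forall n \near \oo, (T n <= (c + e n)%:E * E n)%E.
Proof.
move=> E_pos T_ge0 T_le; pose e n := Num.max 0 (fine (T n) / fine (E n) - c).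
exists e.
  apply/cvgrPdist_le => d d0; near=> n.
  have [r r0 En] : exists2 r : R, 0 < r & E n = r%:E by near: n.
  have : (0 <= T n)%E by near: n.
  have : (T n <= (c + d)%:E * E n)%E by near: n; exact: T_le.
  rewrite /e sub0r normrN En -EFinM; case: (T n) => //= s; rewrite !lee_fin => sr s0.
  have h : s / r - c <= d by rewrite lerBlDl ler_pdivrMr.
  by rewrite ger0_norm ?le_max ?lexx // ge_max h ltW.
near=> n.
have [r r0 En] : exists2 r : R, 0 < r & E n = r%:E by near: n.
have : (0 <= T n)%E by near: n.
have : (T n <= (c + 1)%:E * E n)%E by near: n; exact: T_le.
rewrite /e En -!EFinM; case: (T n) => //= s _ _; rewrite lee_fin -ler_pdivrMr //.
by rewrite -lerBlDl le_max lexx orbT.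
Unshelve. all: by end_near. Qed.

(** Finiteness of T matters because [fine] sends +oo to 0, which would spoil the limit of e. *)
Lemma ratio_lower (E T : nat -> \bar R) (c : R) :
  (\forall n \near \oo, exists2 r : R, 0 < r & E n = r%:E) ->
  (\forall n \near \oo, T n \is a fin_num) ->
  (forall d : R, 0 < d -> \forall n \near \oo, ((c - d)%:E * E n <= T n)%E) ->
  exists2 e : nat -> R, e n @[n --> \oo] --> 0 &
    \forall n \near \oo, ((c + e n)%:E * E n <= T n)%E.
Proof.
move=> E_pos T_fin T_ge; pose e n := Num.min 0 (fine (T n) / fine (E n) - c).
exists e.
  apply/cvgrPdist_le => d d0; near=> n.
  have [r r0 En] : exists2 r : R, 0 < r & E n = r%:E by near: n.
  have : T n \is a fin_num by near: n.
  have : ((c - d)%:E * E n <= T n)%E by near: n; exact: T_ge.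
  rewrite /e sub0r normrN En -EFinM; case: (T n) => //= s; rewrite !lee_fin => sr _.
  have h : - d <= s / r - c by rewrite lerBrDl ler_pdivlMr.
  by rewrite ler0_norm ?ge_min ?lexx // lerNl le_min h oppr_le0 ltW.
near=> n.
have [r r0 En] : exists2 r : R, 0 < r & E n = r%:E by near: n.
have : T n \is a fin_num by near: n.
rewrite /e En -!EFinM; case: (T n) => //= s _; rewrite lee_fin -ler_pdivlMr //.
by rewrite -lerBrDl ge_min lexx orbT.
Unshelve. all: by end_near. Qed.

End Ratio.

(** * Passage from single walks to the sequence of graphs *)

Local Open Scope classical_set_scope.
Local Open Scope ring_scope.

Theorem theorem1p3 (R : realType) (G : nat -> fin_graph)
    (o : forall n : nat, G n)
    (mu : forall n : nat, {ffun G n -> bool} * G n -> R)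
    (G_connected : forall n : nat, graph_connected (G n))
    (G_transitive : forall n : nat, vertex_transitive (G n))
    (G_size : #|G n| @[n --> \oo] --> \oo)
    (G_aperiodic : forall n : nat, aperiodic (@srw R (G n)))
    (mu_stationary : forall n : nat,
       stationary (lamplighter_walk (@srw R (G n))) (mu n)) :
  let EC := fun n : nat => expected_cover_time (@srw R (G n)) (o n) in
  let Tv := fun (eps : R) (n : nat) =>
    mixing_time (lamplighter_walk (@srw R (G n))) (mu n) eps in
  (forall eps : R, 0 < eps < 1 ->
    exists c1 c2 : R, [/\ 0 < c1, 0 < c2 &
      exists d1 d2 : nat -> R,
        [/\ d1 n @[n --> \oo] --> 0, d2 n @[n --> \oo] --> 0 &
          \forall n \near \oo,
            ((c1 + d1 n)%:E * EC n <= Tv eps n)%E /\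
            (Tv eps n <= (c2 + d2 n)%:E * EC n)%E]]) /\
  ((forall e : R, 0 < e ->
      \forall n \near \oo,
        (max_hitting_time (@srw R (G n)) <= e%:E * EC n)%E) ->
   forall eps : R, 0 < eps < 1 ->
     exists d1 d2 : nat -> R,
       [/\ d1 n @[n --> \oo] --> 0, d2 n @[n --> \oo] --> 0 &
         \forall n \near \oo,
           ((2^-1 + d1 n)%:E * EC n <= Tv eps n)%E /\
           (Tv eps n <= (1 + d2 n)%:E * EC n)%E]).
Proof.
move=> EC Tv.
have G_big (a : R) : \forall n \near \oo, a <= #|G n|%:R.
  have /cvgnyPge/(_ (Num.trunc a).+1) := G_size; apply: filterS => n.
  by rewrite -(ler_nat R); apply: le_trans; rewrite ltW // truncnS_gt.
(* Only eventually: a single vertex without a loop has degree 0. *)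
have G_walk : \forall n \near \oo, walk (@srw R (G n)).
  have /cvgnyPge/(_ 2) := G_size; apply: filterS => n card_n.
  exact: srw_walk.
have EC_E n : walk (@srw R (G n)) -> EC n = (hmax (@srw R (G n)) finset.setT)%:E.
  move=> wn; rewrite /EC expected_cover_timeE ?ht_full //.
  - exact: walk_ge0 wn.
  - exact: walk_sum1 wn.
  - exact: walk_bounded wn.
have EC_pos : \forall n \near \oo, exists2 r : R, 0 < r & EC n = r%:E.
  apply: filterS G_walk => n wn; rewrite EC_E //; exists (hmax (@srw R (G n)) finset.setT) => //.
  by have := EC_gt0 wn; lra.
have Tv_ge0 eps : \forall n \near \oo, (0 <= Tv eps n)%E.
  by apply: nearW => n; apply: le_ereal_inf_tmp => _ [t _ <-]; rewrite lee_fin.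
split=> [eps eps01|t_small eps eps01].
  have [c1 [N0 [c1_gt0 lower]]] := lamp_lower_EC eps01.
  have [c2 c2_gt0 upper] := lamp_upper_EC eps01.
  (* The bounds hold with fixed constants for all large n, so the o(1) terms are 0. *)
  exists c1, c2; split=> //; exists (fun=> 0), (fun=> 0).
  split; [exact: cvg_cst|exact: cvg_cst|].
  near=> n.
  have wn : walk (@srw R (G n)) by near: n.
  rewrite !addr0 EC_E // -!EFinM; split.
    apply: (mixing_time_ge wn (mu_stationary n)) => t; apply: lower => //.
    by near: n.
  have [t tv t_le] := upper _ _ wn.
  by apply: (le_trans (mixing_time_le wn (mu_stationary n) tv)); rewrite lee_fin.
have thit_small (e : R) : 0 < e -> \forall n \near \oo, walk (@srw R (G n)) ->
    thit (@srw R (G n)) <= e * hmax (@srw R (G n)) finset.setT.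
  move=> e0; apply: filterS (t_small e e0) => n + wn.
  rewrite EC_E // -EFinM max_hitting_timeE ?lee_fin //.
  - exact: walk_ge0 wn.
  - exact: walk_sum1 wn.
  - exact: walk_bounded wn.
have up (d : R) : 0 < d -> \forall n \near \oo, (Tv eps n <= (1 + d)%:E * EC n)%E.
  move=> d0; have [eta eta0 upper] := lamp_sharp_upper eps01 d0.
  near=> n.
  have wn : walk (@srw R (G n)) by near: n.
  have small : thit (@srw R (G n)) <= eta * hmax (@srw R (G n)) finset.setT.
    by move: wn; near: n; exact: thit_small.
  have [t tv t_le] := upper _ _ wn small.
  rewrite EC_E // -EFinM.
  by apply: (le_trans (mixing_time_le wn (mu_stationary n) tv)); rewrite lee_fin.
have low (d : R) : 0 < d -> \forall n \near \oo, ((2^-1 - d)%:E * EC n <= Tv eps n)%E.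
  move=> d0; have [eta [N0 [eta0 lower]]] := lamp_sharp_lower eps01 d0.
  near=> n.
  have wn : walk (@srw R (G n)) by near: n.
  have small : thit (@srw R (G n)) <= eta * hmax (@srw R (G n)) finset.setT.
    by move: wn; near: n; exact: thit_small.
  rewrite EC_E // -EFinM; apply: (mixing_time_ge wn (mu_stationary n)) => t tv.
  by rewrite -div1r; apply: lower => //; near: n.
have [d2 d2_lim d2_up] := ratio_upper EC_pos (Tv_ge0 eps) up.
(* Finiteness comes from the upper bound just obtained. *)
have Tv_fin : \forall n \near \oo, Tv eps n \is a fin_num.
  near=> n; rewrite ge0_fin_numE; last by near: n.
  have [r _ En] : exists2 r : R, 0 < r & EC n = r%:E by near: n.
  have : (Tv eps n <= (1 + d2 n)%:E * EC n)%E by near: n.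
  by rewrite En -EFinM => /le_lt_trans; apply; rewrite ltry.
have [d1 d1_lim d1_low] := ratio_lower EC_pos Tv_fin low.
exists d1, d2; split=> //; near=> n; split; by near: n.
Unshelve. all: by end_near. Qed.
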